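(* Let $A$ be a nonsemisimple symmetric Nakayama algebra with $n$ simple modules and Loewy length $w$, so that $w\equiv_n 1$. Let $r\ge 1$, let $x_1,\dots,x_r\in\mathbb{Z}/n$ be pairwise different (the ''special points''), and let $$M=\bigoplus_{i=0}^{n-1} e_iA\ \oplus\ \bigoplus_{i=1}^{r} e_{x_i}A/e_{x_i}J^{w-1}.$$ Then $B:=\operatorname{End}_A(M)$ is a Nakayama algebra and $$\operatorname{domdim}(B)=2\inf\{s\ge 1\mid \exists\, i,j\in\{1,\dots,r\}:\ x_i+s\equiv_n x_j\},$$ that is, twice the minimal directed distance of two special points in the quiver of $A$ (a special point being allowed to be compared with itself, via paths of length at least $1$). Furthermore $B$ has Gorenstein dimension $$2\sup\{u_i\mid i\in\{1,\dots,r\}\},\qquad u_i:=\inf\{b\ge 1\mid \exists\, j\in\{1,\dots,r\}:\ x_i+b\equiv_n x_j\},$$ that is, twice the maximal distance $u_i$ from a special point to the next one.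
   Context: $K$ is an arbitrary field; algebras are finite-dimensional connected $K$-algebras given by quiver and relations (basic and split); modules are finitely generated right modules. $\equiv_n$ denotes equality modulo $n$. A Nakayama algebra is an algebra such that every indecomposable projective left or right module is uniserial. A nonsemisimple selfinjective Nakayama algebra $A$ with $n$ simple modules and Loewy length $w\ge 2$ has the form $A=KQ/\mathcal{R}^w$, where $Q$ is the oriented cycle with vertices $\mathbb{Z}/n$ and one arrow $i\to i+1$ for each $i$, and $\mathcal{R}$ is the ideal generated by the arrows; $J$ denotes the Jacobson radical of $A$, $e_i$ the primitive idempotent at vertex $i$, $e_iA$ is spanned by paths starting at $i$, and the top of $e_iJ^k$ (if nonzero) is the simple module at $i+k$. Such $A$ is symmetric if and only if $w\equiv_n 1$. Dominant dimension: let $0\to B\to I_0\to I_1\to\cdots$ be a minimal injective coresolution of the right regular module $B$. If $I_0$ is not projective, $\operatorname{domdim}(B):=0$; otherwise $\operatorname{domdim}(B):=\sup\{m\mid I_i \text{ is projective for } i=0,\dots,m\}+1$. The Gorenstein dimension of $B$ is the injective dimension of the right regular module $B$. *)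

(* Defs.v *)
From HB Require Import structures.
From mathcomp Require Import all_boot all_order all_algebra all_field.

Set Implicit Arguments.
Unset Strict Implicit.
Unset Printing Implicit Defensive.

Import GRing.Theory.

Local Open Scope ring_scope.

(* The opposite algebra; left B-modules are right modules over B^c. *)
Section ConverseAlgebra.
Variables (K : fieldType) (B : falgType K).
Import VectorInternalTheory.

HB.instance Definition _ := GRing.Zmodule_isLmodule.Build K B^c
  (@scalerA K B) (@scale1r K B) (@scalerDr K B) (fun v a b => @scalerDl K B v a b).

Fact converse_scalerAl (a : K) (u v : B^c) : a *: (u * v) = (a *: u) * v.
Proof. exact: (@scalerAr K B a v u). Qed.
HB.instance Definition _ := GRing.Lmodule_isLalgebra.Build K B^c converse_scalerAl.

Fact converse_scalerAr (a : K) (u v : B^c) : a *: (u * v) = u * (a *: v).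
Proof. exact: (@scalerAl K B a v u). Qed.
HB.instance Definition _ := GRing.Lalgebra_isAlgebra.Build K B^c converse_scalerAr.

Fact converse_vect_iso : Vector.axiom (dim B) B^c.
Proof.
exists (v2r : B -> 'rV_(dim B)); first by move=> a u v; exact: (@linearP K B).
by exists (r2v : _ -> B); [exact: v2rK | exact: r2vK].
Qed.
HB.instance Definition _ := Lmodule_hasFinDim.Build K B^c converse_vect_iso.
End ConverseAlgebra.

(* Finite-dimensional (equivalently, finitely generated) right modules. *)

Record rmod (K : fieldType) (A : falgType K) := RMod {
  rmod_sort :> vectType K;
  ract : rmod_sort -> A -> rmod_sort;
  ract_linearl : forall a, linear (ract^~ a);
  ract_linearr : forall v, linear (ract v);
  ract1 : forall v, ract v 1 = v;
  ractM : forall v a b, ract v (a * b) = ract (ract v a) b }.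

Section Modules.
Variables (K : fieldType) (A : falgType K).
Implicit Types (M N P E X S : rmod A) (a b : A).

Definition regmod : rmod A := @RMod K A A (fun v a => v * a)
  (fun a k u v => etrans (mulrDl _ _ _) (congr1 (+%R^~ _) (esym (scalerAl k u a))))
  (fun v k a b => etrans (mulrDr _ _ _) (congr1 (+%R^~ _) (esym (scalerAr k v a))))
  (@mulr1 A) (fun v a b => mulrA v a b).

Definition is_hom M N (f : 'Hom(M, N)) : Prop :=
  forall v a, f (ract v a) = ract (f v) a.

Definition isomorphic M N : Prop :=
  exists f : 'Hom(M, N), [/\ is_hom f, lker f = 0%VS & limg f = fullv].

Definition submodule M (U : {vspace M}) : Prop :=
  forall v a, v \in U -> ract v a \in U.

Definition simple_mod M : Prop := {:M}%VS <> 0%VS /\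
  forall U : {vspace M}, submodule U -> U = 0%VS \/ U = fullv.

Definition indecomposable M : Prop := {:M}%VS <> 0%VS /\
  forall U V : {vspace M}, submodule U -> submodule V ->
    (U + V = fullv)%VS -> (U :&: V = 0)%VS -> U = 0%VS \/ V = 0%VS.

Definition uniserial M : Prop :=
  forall U V : {vspace M}, submodule U -> submodule V ->
    (U <= V)%VS \/ (V <= U)%VS.

Definition projective P : Prop :=
  forall (M N : rmod A) (g : 'Hom(M, N)) (f : 'Hom(P, N)),
    is_hom g -> limg g = fullv -> is_hom f ->
    exists h : 'Hom(P, M), is_hom h /\ (g \o h)%VF = f.

Definition injective_mod E : Prop :=
  forall (M N : rmod A) (g : 'Hom(M, N)) (f : 'Hom(M, E)),
    is_hom g -> lker g = 0%VS -> is_hom f ->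
    exists h : 'Hom(N, E), is_hom h /\ (h \o g)%VF = f.

Definition essential E (U : {vspace E}) : Prop :=
  forall V : {vspace E}, submodule V -> V <> 0%VS -> (U :&: V)%VS <> 0%VS.

(* Exactness of 0 -> X -> I 0 -> I 1 -> ..., with all I i injective. *)
Definition inj_cores X (I : nat -> rmod A) (eps : 'Hom(X, I 0))
    (d : forall i, 'Hom(I i, I i.+1)) : Prop :=
  [/\ forall i, injective_mod (I i),
      is_hom eps /\ forall i, is_hom (d i),
      lker eps = 0%VS,
      limg eps = lker (d 0) &
      forall i, limg (d i) = lker (d i.+1)].

(* Minimality: each I i is an injective envelope of the preceding cokernel. *)
Definition min_inj_cores X (I : nat -> rmod A) (eps : 'Hom(X, I 0))
    (d : forall i, 'Hom(I i, I i.+1)) : Prop :=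
  [/\ inj_cores eps d,
      essential (limg eps) &
      forall i, essential (limg (d i))].

Definition injdim_le X (m : nat) : Prop :=
  exists (I : nat -> rmod A) (eps : 'Hom(X, I 0))
         (d : forall i, 'Hom(I i, I i.+1)),
    inj_cores eps d /\ forall i, (m < i)%N -> {:I i}%VS = 0%VS.

(* The injective dimension of X is finite and equal to m. *)
Definition is_injdim X (m : nat) : Prop :=
  injdim_le X m /\ forall k, injdim_le X k -> (m <= k)%N.

Definition is_max (S : nat -> Prop) (m : nat) : Prop :=
  S m /\ forall k, S k -> (k <= m)%N.

(* domdim, read off from the terms I 0, I 1, ... of a coresolution, is finite
   and equal to m; the sup in its definition is then a maximum. *)
Definition domdim_along (I : nat -> rmod A) (m : nat) : Prop :=
  match m with
  | 0 => ~ projective (I 0)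
  | m'.+1 => projective (I 0) /\
      is_max (fun k => forall i, (i <= k)%N -> projective (I i)) m'
  end.

End Modules.

Section SubQuotientSum.
Variables (K : fieldType) (A : falgType K).

Section Sub.
Variables (M : rmod A) (U : {vspace M}) (sU : submodule U).

Definition sub_act (v : subvs_of U) (a : A) : subvs_of U :=
  Subvs (sU a (subvsP v)).

Fact sub_act_linearl a : linear (sub_act^~ a).
Proof. by move=> k u v; apply/val_inj; rewrite /= ract_linearl. Qed.
Fact sub_act_linearr v : linear (sub_act v).
Proof. by move=> k a b; apply/val_inj; rewrite /= ract_linearr. Qed.
Fact sub_act1 v : sub_act v 1 = v.
Proof. by apply/val_inj; rewrite /= ract1. Qed.
Fact sub_actM v a b : sub_act v (a * b) = sub_act (sub_act v a) b.
Proof. by apply/val_inj; rewrite /= ractM. Qed.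

Definition submod : rmod A :=
  RMod sub_act_linearl sub_act_linearr sub_act1 sub_actM.
End Sub.

(* M / U, carried by the chosen complement U^C of U: a class is represented by
   its component in U^C along U (see quot_proj below). *)
Section Quotient.
Variables (M : rmod A) (U : {vspace M}) (sU : submodule U).

Let pi : 'End(M) := daddv_pi (U^C)%VS U.

Let CU0 : (U^C :&: U = 0)%VS. Proof. by rewrite capvC capv_compl. Qed.
Let piC v : pi v \in (U^C)%VS. Proof. exact: memv_pi. Qed.
Let pi_id v : v \in (U^C)%VS -> pi v = v. Proof. exact: daddv_pi_id. Qed.
Let pi_sub v : v - pi v \in U.
Proof.
have vD : v \in (U^C + U)%VS by rewrite addvC addv_complf memvf.
by rewrite -{1}(daddv_pi_add CU0 vD) addrC addKr memv_pi.
Qed.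
Let pi_ker v : v \in U -> pi v = 0.
Proof.
move=> vU; apply/eqP; rewrite -memv0 -CU0 memv_cap piC /=.
by rewrite -[pi v](subKr v) memvB.
Qed.
Let pi_act v a : pi (ract (pi v) a) = pi (ract v a).
Proof.
apply/eqP; rewrite eq_sym -subr_eq0 -linearB /=; apply/eqP/pi_ker.
have -> : ract v a - ract (pi v) a = ract (v - pi v) a.
  by rewrite -scaleN1r addrC -(ract_linearl a) scaleN1r addrC.
exact/sU/pi_sub.
Qed.

Definition quot_class (v : M) : subvs_of (U^C)%VS := Subvs (piC v).
Definition quot_act (v : subvs_of (U^C)%VS) (a : A) : subvs_of (U^C)%VS :=
  quot_class (ract (vsval v) a).

Fact quot_act_linearl a : linear (quot_act^~ a).
Proof. by move=> k u v; apply/val_inj; rewrite /= ract_linearl linearP. Qed.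
Fact quot_act_linearr v : linear (quot_act v).
Proof. by move=> k a b; apply/val_inj; rewrite /= ract_linearr linearP. Qed.
Fact quot_act1 v : quot_act v 1 = v.
Proof. by apply/val_inj; rewrite /= ract1 pi_id ?subvsP. Qed.
Fact quot_actM v a b : quot_act v (a * b) = quot_act (quot_act v a) b.
Proof. by apply/val_inj; rewrite /= ractM pi_act. Qed.

Definition quotmod : rmod A :=
  RMod quot_act_linearl quot_act_linearr quot_act1 quot_actM.

Fact quot_class_linear : linear (quot_class : M -> quotmod).
Proof. by move=> k u v; apply/val_inj; rewrite /= linearP. Qed.
HB.instance Definition _ := GRing.isLinear.Build K M quotmod _
  (quot_class : M -> quotmod) quot_class_linear.

Definition quot_proj : 'Hom(M, quotmod) := linfun (quot_class : M -> quotmod).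

Lemma quot_proj_hom : is_hom quot_proj.
Proof. by move=> v a; apply/val_inj; rewrite /quot_proj !lfunE /= pi_act. Qed.

Lemma quot_proj_full : limg quot_proj = fullv.
Proof.
apply/eqP; rewrite eqEsubv subvf; apply/subvP => v _.
apply/memv_imgP; exists (vsval v); first exact: memvf.
by apply/val_inj; rewrite /quot_proj lfunE /= pi_id ?subvsP.
Qed.

Lemma quot_proj_ker : lker quot_proj = U.
Proof.
apply/vspaceP => v; rewrite memv_ker /quot_proj lfunE /=.
apply/eqP/idP => [/(congr1 val)/= v0 | vU]; last exact/val_inj/pi_ker.
by rewrite -[v]subr0 -v0 pi_sub.
Qed.
End Quotient.

Section Sum.
Variables M N : rmod A.

Definition dsum_act (v : (M * N)%type) (a : A) : (M * N)%type :=
  (ract v.1 a, ract v.2 a).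

Fact dsum_act_linearl a : linear (dsum_act^~ a).
Proof. by move=> k u v; rewrite /dsum_act /= !ract_linearl. Qed.
Fact dsum_act_linearr v : linear (dsum_act v).
Proof. by move=> k a b; rewrite /dsum_act /= !ract_linearr. Qed.
Fact dsum_act1 v : dsum_act v 1 = v.
Proof. by case: v => u v; rewrite /dsum_act /= !ract1. Qed.
Fact dsum_actM v a b : dsum_act v (a * b) = dsum_act (dsum_act v a) b.
Proof. by rewrite /dsum_act /= !ractM. Qed.

Definition dsum : rmod A :=
  RMod dsum_act_linearl dsum_act_linearr dsum_act1 dsum_actM.
End Sum.

Fact submodule0 : submodule (0%VS : {vspace regmod A}).
Proof. by move=> v a; rewrite !memv0 => /eqP->; rewrite /= mul0r. Qed.

Definition zeromod : rmod A := submod submodule0.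

Fact rideal_submodule (U : {vspace A}) :
  submodule ((U * fullv)%VS : {vspace regmod A}).
Proof.
move=> v a vU; have : (U * fullv * fullv <= U * fullv)%VS.
  by rewrite -prodvA prodvSr ?subvf.
by move/prodvP; apply=> //; apply: memvf.
Qed.

Definition emod (e : A) : rmod A := submod (@rideal_submodule <[e]>%VS).

(* The submodule e U of e A, for a right ideal U; the trailing factor A makes
   it a submodule for every U, and changes nothing when U is a right ideal. *)
Definition esub (e : A) (U : {vspace A}) : {vspace emod e} :=
  (linfun (vsval : emod e -> A) @^-1: (<[e]> * U * fullv))%VS.

Fact esub_submodule e U : submodule (esub e U).
Proof.
move=> v a; rewrite /esub -!memv_preim !lfunE /=.
exact: (@rideal_submodule (<[e]> * U)%VS).
Qed.

Definition equot (e : A) (U : {vspace A}) : rmod A :=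
  quotmod (@esub_submodule e U).

End SubQuotientSum.

Arguments zeromod {K A}.

Section AlgebraProperties.
Variables (K : fieldType) (B : falgType K).

Definition connected_alg : Prop :=
  forall c : B, c * c = c -> (forall b, c * b = b * c) -> c = 0 \/ c = 1.

(* B = e_1 B + ... + e_m B, a direct sum of pairwise nonisomorphic
   indecomposable modules. *)
Definition basic_alg : Prop :=
  exists (m : nat) (e : 'I_m -> B),
    [/\ forall i j, e i * e j = if i == j then e i else 0,
        \sum_i e i = 1,
        forall i, indecomposable (emod (e i)) &
        forall i j, i != j -> ~ isomorphic (emod (e i)) (emod (e j))].

Definition split_alg : Prop :=
  forall (S : rmod B) (f : 'End(S)), simple_mod S -> is_hom f ->
    exists c : K, f = c *: \1%VF.

Definition symmetric_algebra : Prop :=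
  exists lambda : 'Hom(B, K^o),
    (forall a b, lambda (a * b) = lambda (b * a)) /\
    (forall a, (forall b, lambda (a * b) = 0) -> a = 0).

Definition maximal_right_ideal (U : {vspace B}) : Prop :=
  [/\ submodule (U : {vspace regmod B}), U <> fullv &
      forall V : {vspace B}, submodule (V : {vspace regmod B}) ->
        (U <= V)%VS -> V = U \/ V = fullv].

(* domdim B is finite and equal to m: a minimal injective coresolution of B
   exists, and each of them yields the value m. *)
Definition is_domdim (m : nat) : Prop :=
  (exists (I : nat -> rmod B) (eps : 'Hom(regmod B, I 0))
          (d : forall i, 'Hom(I i, I i.+1)), min_inj_cores eps d) /\
  (forall (I : nat -> rmod B) (eps : 'Hom(regmod B, I 0))
          (d : forall i, 'Hom(I i, I i.+1)),
     min_inj_cores eps d -> domdim_along I m).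

Definition is_gorenstein_dim (m : nat) : Prop := is_injdim (regmod B) m.

End AlgebraProperties.

(* Algebras are understood to be connected, basic and split. *)
Definition nakayama (K : fieldType) (B : falgType K) : Prop :=
  [/\ connected_alg B, basic_alg B, split_alg B,
      forall P : rmod B, indecomposable P -> projective P -> uniserial P &
      forall P : rmod (B^c : falgType K),
        indecomposable P -> projective P -> uniserial P].

(* cycalg K n w is K Q / R^(w+1), for Q the oriented cycle with vertices
   Z/(n+1). A path is determined by its source i and its length l, and those
   with l <= w form a basis; an element is its family of coefficients, and the
   product is the concatenation of paths, "first factor first". *)
Section CyclicNakayama.
Variables (K : fieldType) (n w : nat).

Definition cycalg := {ffun 'I_n.+1 * 'I_w.+1 -> K^o}.

HB.instance Definition _ := Vector.on cycalg.

Implicit Types (f g h : cycalg) (i j : 'I_n.+1) (k l : nat).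

Definition cyc_mul f g : cycalg :=
  [ffun u : 'I_n.+1 * 'I_w.+1 => \sum_(l < u.2.+1)
     (f (u.1, inord l) : K) * g (inZp (u.1 + l), inord (u.2 - l))].
Definition cyc_one : cycalg := [ffun u : 'I_n.+1 * 'I_w.+1 => (u.2 == 0 :> nat)%:R].

Fact cyc_mulA : associative cyc_mul.
Proof.
move=> f g h; apply/ffunP => -[i [k ltk]]; rewrite !ffunE /=.
pose F l m : K := (f (i, inord l) : K) * (g (inZp (i + l), inord (m - l)) : K)
  * h (inZp (i + m), inord (k - m)).
transitivity (\sum_(l < k.+1) \sum_(m < (k - l).+1) F l (l + m)%N).
  apply: eq_bigr => -[l ltl] _ /=; rewrite ffunE /= mulr_sumr.
  have lw : (l < w.+1)%N by apply: leq_trans ltl ltk.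
  have klw : (k - l < w.+1)%N by rewrite ltnS (leq_trans (leq_subr _ _)).
  rewrite inordK //; apply: eq_bigr => -[m ltm] _ /=.
  rewrite /F mulrA addKn subnDA; congr (_ * h (_, _)).
  by apply: val_inj; rewrite /= modnDml addnA.
transitivity (\sum_(m < k.+1) \sum_(l < m.+1) F l m); last first.
  apply: eq_bigr => -[m ltm] _ /=; rewrite ffunE /= mulr_suml.
  by rewrite inordK // (leq_trans ltm).
rewrite -[RHS](big_mkord xpredT (fun m => \sum_(l < m.+1) F l m)).
rewrite -(big_mkord xpredT (fun l => \sum_(m < (k - l).+1) F l (l + m)%N)).
transitivity (\sum_(0 <= l < k.+1) \sum_(0 <= m < k.+1 | (l <= m)%N) F l m).
  rewrite !big_nat; apply: eq_bigr => l /andP[_ ltl].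
  rewrite -(big_mkord xpredT (fun m => F l (l + m)%N)).
  rewrite [RHS](big_cat_nat (n := l)) //= 1?ltnW //.
  rewrite [X in _ = X + _]big_nat_cond [X in _ = X + _]big1 ?add0r => [|m]; last first.
    by case/andP=> /andP[_ lt_ml]; rewrite leqNgt lt_ml.
  transitivity (\sum_(0 + l <= m < k.+1 | (l <= m)%N) F l m); last by rewrite add0n.
  rewrite big_addn subSn //.
  rewrite big_mkcond [RHS]big_mkcond; apply: eq_bigr => m _.
  by rewrite leq_addl addnC.
rewrite (exchange_big_dep_nat xpredT) //=.
rewrite !big_nat; apply: eq_bigr => m /andP[_ ltm].
rewrite -(big_mkord xpredT (F^~ m)).
rewrite (big_cat_nat (n := m.+1)) //= addrC.
rewrite big_nat_cond big1 ?add0r => [|l]; last first.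
  by case/andP=> /andP[lt_ml _]; rewrite leqNgt lt_ml.
by rewrite big_nat_cond [RHS]big_nat_cond; apply: eq_bigl => l; rewrite ltnS andbT; case: (l <= m)%N.
Qed.

Fact inZp_ord i : inZp i = i.
Proof. by apply: val_inj; rewrite /= modn_small. Qed.

Fact cyc_mul1 : left_id cyc_one cyc_mul.
Proof.
move=> f; apply/ffunP => -[i k]; rewrite !ffunE /= big_ord_recl /= ffunE /=.
rewrite inordK // eqxx mul1r addn0 inZp_ord subn0 inord_val.
rewrite big1 ?addr0 // => -[l ltl] _; rewrite ffunE /= inordK ?mul0r //.
by rewrite /bump /= ltnS (leq_trans ltl) // -ltnS.
Qed.

Fact cyc_mulr1 : right_id cyc_one cyc_mul.
Proof.
move=> f; apply/ffunP => -[i k]; rewrite !ffunE /= big_ord_recr /= ffunE /=.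
rewrite subnn inordK // eqxx mulr1 inord_val.
rewrite big1 ?add0r // => -[l ltl] _; rewrite ffunE /= inordK.
  by rewrite subn_eq0 leqNgt ltl mulr0.
by rewrite (leq_ltn_trans (leq_subr _ _)).
Qed.

Fact cyc_mulDl : left_distributive cyc_mul +%R.
Proof.
move=> f g h; apply/ffunP => u; rewrite !ffunE -big_split /=.
by apply: eq_bigr => l _; rewrite !ffunE mulrDl.
Qed.

Fact cyc_mulDr : right_distributive cyc_mul +%R.
Proof.
move=> f g h; apply/ffunP => u; rewrite !ffunE -big_split /=.
by apply: eq_bigr => l _; rewrite !ffunE mulrDr.
Qed.

Fact cyc_one_neq0 : cyc_one != 0.
Proof.
by apply/eqP => /ffunP/(_ (ord0, ord0)); rewrite !ffunE => /eqP; rewrite oner_eq0.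
Qed.

HB.instance Definition _ := GRing.Zmodule_isNzRing.Build cycalg
  cyc_mulA cyc_mul1 cyc_mulr1 cyc_mulDl cyc_mulDr cyc_one_neq0.

Fact cyc_scalerAl (a : K) f g : a *: (f * g) = (a *: f) * g.
Proof.
apply/ffunP => u; rewrite !ffunE scaler_sumr.
by apply: eq_bigr => l _; rewrite !ffunE; apply: mulrA.
Qed.
HB.instance Definition _ := GRing.Lmodule_isLalgebra.Build K cycalg cyc_scalerAl.

Fact cyc_scalerAr (a : K) f g : a *: (f * g) = f * (a *: g).
Proof.
apply/ffunP => u; rewrite !ffunE scaler_sumr.
by apply: eq_bigr => l _; rewrite !ffunE; apply: mulrCA.
Qed.
HB.instance Definition _ := GRing.Lalgebra_isAlgebra.Build K cycalg cyc_scalerAr.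
HB.instance Definition _ := Algebra_isFalgebra.Build K cycalg.

(* The class of the path of length l from i; it is 0 if l > w. *)
Definition cyc_path i l : cycalg := [ffun u : 'I_n.+1 * 'I_w.+1 => ((u.1 == i) && (u.2 == l :> nat))%:R].

Definition cyc_idem i : cycalg := cyc_path i 0.

(* The ideal generated by the arrows. *)
Definition cyc_rad : {vspace cycalg} :=
  (fullv * <<[seq cyc_path i 1 | i <- enum 'I_n.+1]>> * fullv)%VS.

Lemma cyc_mulE f g i (k : 'I_w.+1) : (f * g) (i, k) =
  \sum_(l < k.+1) (f (i, inord l) : K) * g (inZp (i + l), inord (k - l)).
Proof. by rewrite ffunE. Qed.

Lemma cyc_pathM i j k l :
  cyc_path i k * cyc_path j l =
  if inZp (i + k) == j then cyc_path i (k + l) else 0.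
Proof.
apply/ffunP => -[i' m]; rewrite cyc_mulE.
have E (t : 'I_m.+1) : (cyc_path i k (i', inord t) : K)
    * cyc_path j l (inZp (i' + t), inord (m - t)) =
  ([&& i' == i, t == k :> nat, inZp (i + k) == j & m == (k + l)%N :> nat])%:R.
  rewrite !ffunE /= -natrM mulnb.
  have tm : (t <= m)%N by rewrite -ltnS.
  have mw : (m <= w)%N by rewrite -ltnS.
  rewrite !inordK ?ltnS ?(leq_trans tm) ?(leq_trans (leq_subr _ _)) //.
  case: eqP => //= ->; case: eqP => //= <-.
  by rewrite -(eqn_add2l t (m - t)) subnKC.
rewrite (eq_bigr _ (fun t _ => E t)).
case: (inZp (i + k) =P j) => _; last first.
  by rewrite ffunE big1 // => t _; rewrite !andbF.
rewrite ffunE /=; case: (i' =P i) => _ /=; last by rewrite big1.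
case: (val m =P (k + l)%N) => mE; last first.
  by rewrite big1 ?[RHS]mulr0n // => t _; rewrite andbF.
have km : (k < m.+1)%N by rewrite ltnS mE leq_addr.
rewrite (bigD1 (Ordinal km)) //= eqxx big1 ?addr0 // => t.
by rewrite -val_eqE /= => /negPf->.
Qed.

Lemma cyc_expand f : f = \sum_u f u *: cyc_path u.1 u.2.
Proof.
apply/ffunP => u; rewrite sum_ffunE (bigD1 u) //= !ffunE !eqxx /=.
rewrite big1 ?addr0; first by rewrite /GRing.scale /= mulr1.
move=> v; rewrite eq_sym !ffunE -pair_eqE /pair_eq /= => /negPf vu.
by rewrite val_eqE vu scaler0.
Qed.

Definition cyc_ev i f : K^o := f (i, ord0).
Fact cyc_ev_linear i : linear (cyc_ev i).
Proof. by move=> k f g; rewrite /cyc_ev !ffunE. Qed.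
HB.instance Definition _ i :=
  GRing.isLinear.Build K cycalg K^o _ (cyc_ev i) (cyc_ev_linear i).

Lemma cyc_evM i f g : cyc_ev i (f * g) = cyc_ev i f * cyc_ev i g.
Proof.
rewrite /cyc_ev cyc_mulE big_ord_recl big_ord0 addr0 /= addn0 inZp_ord.
by rewrite (_ : inord 0 = ord0) //; apply: val_inj; rewrite /= inordK.
Qed.

Lemma cyc_radP f : reflect (forall i, f (i, ord0) = 0) (f \in cyc_rad).
Proof.
apply: (iffP idP) => [fJ i|f0].
  have sJ : (cyc_rad <= lker (linfun (cyc_ev i)))%VS.
    apply/prodvP => a b aJ _; rewrite memv_ker lfunE /= cyc_evM.
    suff -> : cyc_ev i a = 0 by rewrite mul0r.
    have sJ : (fullv * <<[seq cyc_path j 1 | j <- enum 'I_n.+1]>>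
               <= lker (linfun (cyc_ev i)))%VS.
      apply/prodvP => b' c _ cR; rewrite memv_ker lfunE /= cyc_evM.
      suff -> : cyc_ev i c = 0 by rewrite mulr0.
      have sR : (<<[seq cyc_path j 1 | j <- enum 'I_n.+1]>>
                 <= lker (linfun (cyc_ev i)))%VS.
        apply/span_subvP => _ /mapP[j _ ->].
        by rewrite memv_ker lfunE /= /cyc_ev ffunE /= andbF.
      by have := subvP sR _ cR; rewrite memv_ker lfunE /= => /eqP.
    by have := subvP sJ _ aJ; rewrite memv_ker lfunE /= => /eqP.
  by have := subvP sJ _ fJ; rewrite memv_ker lfunE /= => /eqP.
rewrite [f]cyc_expand; apply: rpred_sum => -[i [l ltl]] _ /=.
case: l ltl => [|l] ltl.
  have -> : Ordinal ltl = ord0 by apply: val_inj.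
  by rewrite f0 scale0r mem0v.
apply/memvZ.
have -> : cyc_path i l.+1
    = cyc_path i 0 * cyc_path i 1 * cyc_path (inZp (i + 1)) l.
  by rewrite !cyc_pathM addn0 inZp_ord eqxx cyc_pathM eqxx.
apply: memv_mul (memvf _); apply: memv_mul (memvf _) _.
by apply/memv_span/map_f; rewrite mem_enum.
Qed.

Lemma cyc_rad_nil f m i (k : 'I_w.+1) :
  f \in cyc_rad -> (k < m)%N -> (f ^+ m) (i, k) = 0.
Proof.
move=> /cyc_radP f0; elim: m i k => // m IHm i k; rewrite ltnS exprS => km.
rewrite cyc_mulE big1 // => -[l ltl] _ /=.
have kw : (k <= w)%N by rewrite -ltnS.
case: l ltl => [|l] ltl.
  by rewrite (_ : inord 0 = ord0) ?f0 ?mul0r //; apply: val_inj; rewrite /= inordK.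
rewrite IHm ?mulr0 // inordK ?ltnS ?(leq_trans (leq_subr _ _)) //.
by rewrite (leq_trans _ km) // ltn_subrL /= (leq_trans _ (ltl : (l < k)%N)).
Qed.

(* cyc_rad is the Jacobson radical. *)
Lemma cyc_rad_jacobson f :
  f \in cyc_rad <-> forall U, maximal_right_ideal U -> f \in U.
Proof.
split=> [fJ U [sU nU maxU] | maxf]; last first.
  apply/cyc_radP => i.
  pose U := lker (linfun (cyc_ev i)).
  suff /maxf : maximal_right_ideal U by rewrite memv_ker lfunE /= => /eqP.
  split=> [g a||V sV sUV].
  - by rewrite !memv_ker !lfunE /= cyc_evM => /eqP->; rewrite mul0r.
  - move=> /vspaceP/(_ (cyc_idem i)).
    by rewrite memvf memv_ker lfunE /= /cyc_ev ffunE !eqxx /= oner_eq0.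
  have [sVU|/subvPn[v vV]] := boolP (V <= U)%VS.
    by left; apply/eqP; rewrite eqEsubv sVU.
  rewrite memv_ker lfunE /= => v0; right; apply/eqP; rewrite eqEsubv subvf.
  apply/subvP=> g _; pose c := cyc_ev i g / cyc_ev i v.
  rewrite -[g](subrK (c *: v)) memvD ?memvZ // (subvP sUV) //.
  rewrite memv_ker lfunE /= linearB linearZ /= subr_eq0 /c.
  by rewrite /GRing.scale /= divfK.
apply: contraT => fU.
have sfA : submodule ((<[f]> * fullv)%VS : {vspace regmod cycalg}).
  exact: rideal_submodule.
have sUf : submodule ((U + <[f]> * fullv)%VS : {vspace regmod cycalg}).
  move=> _ a /memv_addP[u uU [v vf ->]].
  by rewrite [ract _ _]mulrDl memv_add //; [apply: sU | apply: sfA].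
have fUf : f \in (U + <[f]> * fullv)%VS.
  have ffA : f * 1 \in (<[f]> * fullv)%VS by rewrite memv_mul ?memv_line ?memvf.
  by rewrite mulr1 in ffA; apply: subvP ffA; apply: addvSr.
have [UE|UE] := maxU _ sUf (addvSl _ _).
  by rewrite UE in fUf; rewrite fUf in fU.
have /memv_addP[u uU [v]] : 1 \in (U + <[f]> * fullv)%VS by rewrite UE memvf.
move=> vf u1; have vJ : v \in cyc_rad.
  apply: subvP vf; apply/prodvP => _ b /vlineP[k ->] _.
  rewrite -scalerAl memvZ //; apply/cyc_radP => i.
  by move/cyc_radP: fJ => f0; have := cyc_evM i f b; rewrite /cyc_ev f0 mul0r.
have u_unit : u * (\sum_(m < w.+1) v ^+ m) = 1.
  have -> : u = 1 - v by rewrite u1 addrK.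
  rewrite -opprB mulNr -subrX1 (_ : v ^+ w.+1 = 0) ?sub0r ?opprK //.
  by apply/ffunP => -[i k]; rewrite cyc_rad_nil // ffunE.
case: nU; apply/eqP; rewrite eqEsubv subvf; apply/subvP => g _.
by rewrite -[g]mul1r -u_unit; apply: (sU); apply: (sU).
Qed.

Lemma cyc_path0 i l : (w < l)%N -> cyc_path i l = 0.
Proof.
move=> wl; apply/ffunP => -[j [k ltk]]; rewrite !ffunE /=.
by rewrite (ltn_eqF (leq_trans ltk wl)) andbF.
Qed.

Definition cyc_soc f : K^o := \sum_i f (i, ord_max).
Fact cyc_soc_linear : linear cyc_soc.
Proof.
move=> k f g; rewrite /cyc_soc scaler_sumr -big_split /=.
by apply: eq_bigr => i _; rewrite !ffunE.
Qed.
HB.instance Definition _ :=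
  GRing.isLinear.Build K cycalg K^o _ cyc_soc cyc_soc_linear.

Lemma cyc_symmetricP : symmetric_algebra cycalg <-> w.+1 = 1 %[mod n.+1].
Proof.
have wmod : (w.+1 == 1 %[mod n.+1]) = (n.+1 %| w)%N.
  by rewrite -addn1 -{2}[1%N]add0n eqn_modDr mod0n.
have inZpD i a b : inZp (@inZp n (i + a) + b) = inZp (i + (a + b)) :> 'I_n.+1.
  by apply: val_inj; rewrite /= modnDml addnA.
split=> [[la [laC la0]] | /eqP]; last first.
  rewrite wmod => dw.
  have inZpw i : inZp (i + w) = i.
    apply: val_inj; rewrite /= -modnDmr; move: dw; rewrite /dvdn => /eqP->.
    by rewrite addn0 modn_small.
  have socM f g : linfun cyc_soc (f * g) =
      \sum_(l < w.+1) \sum_i (f (i, l) : K) * g (inZp (i + l), rev_ord l).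
    rewrite lfunE /= /cyc_soc exchange_big /=; apply: eq_bigr => i _.
    rewrite cyc_mulE; apply: eq_bigr => l _.
    rewrite inord_val; congr (_ * g (_, _)); apply: val_inj.
    by rewrite /= subSS inordK // ltnS leq_subr.
  exists (linfun cyc_soc); split=> [f g|f f0].
    rewrite !socM (reindex_inj rev_ord_inj); apply: eq_bigr => l _ /=.
    have rK i : inZp (@inZp n (i + l) + rev_ord l) = i.
      by rewrite inZpD /= subSS subnKC ?inZpw // -ltnS.
    have rK' i : inZp (@inZp n (i + rev_ord l) + l) = i.
      by rewrite inZpD /= subSS subnK ?inZpw // -ltnS.
    rewrite (reindex (fun i => inZp (i + l) : 'I_n.+1)) /=; last first.
      by exists (fun i => inZp (i + rev_ord l)) => i _.
    apply: eq_bigr => i _; rewrite mulrC; congr (g (_, _) * _).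
      exact: rK.
    exact: rev_ordK.
  apply/ffunP => -[i l]; have := f0 (cyc_path (inZp (i + l)) (w - l)).
  rewrite socM (bigD1 l) //= [X in _ + X]big1 ?addr0 => [|k nkl]; last first.
    rewrite big1 // => j _; rewrite ffunE /= subSS eqn_sub2lE ?leq_ord //.
    by rewrite val_eqE (negPf nkl) andbF mulr0.
  rewrite (bigD1 i) //= big1 ?addr0 => [|j nji]; last first.
    rewrite ffunE /=; case: eqP => [/(congr1 val)/= ij|]; last by rewrite mulr0.
    case/eqP: nji; apply: ord_inj; move/eqP: ij.
    by rewrite eqn_modDr !modn_small // => /eqP.
  by rewrite !ffunE /= subSS !eqxx mulr1.
apply/eqP; rewrite wmod; apply: contraT => dw.
pose p := cyc_path ord0 w; have p0 : la p = 0.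
  have : la (cyc_idem ord0 * p) = la (p * cyc_idem ord0) by rewrite laC.
  rewrite !cyc_pathM add0n addn0 inZp_ord eqxx.
  case: eqP => [/(congr1 val)/= /eqP w0|_ -> //]; last by rewrite linear0.
  by case/negP: dw; apply: w0.
have : p = 0.
  apply: la0 => b; rewrite [b]cyc_expand mulr_sumr linear_sum big1 // => u _.
  rewrite -scalerAr linearZ /= cyc_pathM; case: eqP => _; last first.
    by rewrite linear0 scaler0.
  case: (posnP u.2) => [->|u0]; first by rewrite addn0 p0 scaler0.
  by rewrite cyc_path0 ?linear0 ?scaler0 // -[w in (w < _)%N]addn0 ltn_add2l.
move=> /ffunP/(_ (ord0, ord_max)); rewrite !ffunE /= !eqxx => /eqP.
by rewrite oner_eq0.
Qed.
End CyclicNakayama.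

(* The proof nzM only serves to exclude the zero ring; the product of
   endalg nzM = End_A(M) is f * g = f \o g. *)
Section EndomorphismAlgebra.
Variables (K : fieldType) (A : falgType K) (M : rmod A).

Definition ract_at (a : A) (v : M) : M := ract v a.
HB.instance Definition _ a :=
  GRing.isLinear.Build K M M _ (ract_at a) (@ract_linearl K A M a).
Definition ract_lfun (a : A) : 'End(M) := linfun (ract_at a).

Definition comm_ract (a : A) (f : 'End(M)) : 'End(M) :=
  (f \o ract_lfun a)%VF - (ract_lfun a \o f)%VF.

Fact comm_ract_linear a : linear (comm_ract a).
Proof.
move=> k f g; rewrite /comm_ract comp_lfunDl comp_lfunDr -comp_lfunZl -comp_lfunZr.
by rewrite opprD addrACA scalerBr.
Qed.
HB.instance Definition _ a :=
  GRing.isLinear.Build K 'End(M) 'End(M) _ (comm_ract a) (comm_ract_linear a).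

(* The A-linear endomorphisms of M; see endspaceP. *)
Definition endspace : {vspace 'End(M)} :=
  (\bigcap_(i < \dim {:A}) lker (linfun (comm_ract (vbasis {:A})`_i)))%VS.

Lemma endspaceP (f : 'End(M)) : reflect (is_hom f) (f \in endspace).
Proof.
have fE a : reflect (forall v, f (ract v a) = ract (f v) a)
    (f \in lker (linfun (comm_ract a))).
  rewrite memv_ker lfunE /= subr_eq0; apply: (iffP eqP) => [/lfunP fa v|fa].
    by have := fa v; rewrite !comp_lfunE !lfunE.
  by apply/lfunP => v; rewrite !comp_lfunE !lfunE /= /ract_at fa.
apply: (iffP idP) => [fE0 v a | fh]; last first.
  by rewrite memvE; apply/subv_bigcapP => i _; rewrite -memvE; apply/fE.
have actE (u : M) : ract u a = \sum_i coord (vbasis {:A}) i a *: ract u (vbasis {:A})`_i.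
  pose L := GRing.isLinear.Build K A M _ (ract u) (ract_linearr u).
  pose ru : {linear A -> M} := HB.pack (ract u) L.
  have -> : ract u a = ru a by [].
  rewrite {1}(coord_vbasis (memvf a)) linear_sum; apply: eq_bigr => i _.
  by rewrite linearZ.
rewrite !actE linear_sum; apply: eq_bigr => i _; rewrite linearZ /=.
congr (_ *: _); apply/fE; move: fE0; rewrite memvE => /subv_bigcapP/(_ i isT).
by rewrite -memvE.
Qed.

Fact endspace1 : \1%VF \in endspace.
Proof. by apply/endspaceP => v a; rewrite !id_lfunE. Qed.

Fact endspaceM (f g : 'End(M)) :
  f \in endspace -> g \in endspace -> (f \o g)%VF \in endspace.
Proof.
by move=> /endspaceP fh /endspaceP gh; apply/endspaceP => v a;
  rewrite !comp_lfunE gh fh.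
Qed.

Definition endalg (nzM : {:M}%VS <> 0%VS) := subvs_of endspace.

Section Ring.
Variable nzM : {:M}%VS <> 0%VS.
Local Notation E := (endalg nzM).

HB.instance Definition _ := Vector.on E.

Definition end_one : E := Subvs endspace1.
Definition end_mul (f g : E) : E := Subvs (endspaceM (subvsP f) (subvsP g)).

Fact end_mulA : associative end_mul.
Proof. by move=> f g h; apply/val_inj/comp_lfunA. Qed.
Fact end_mul1 : left_id end_one end_mul.
Proof. by move=> f; apply/val_inj/comp_lfun1l. Qed.
Fact end_mulr1 : right_id end_one end_mul.
Proof. by move=> f; apply/val_inj/comp_lfun1r. Qed.
Fact end_mulDl : left_distributive end_mul +%R.
Proof. by move=> f g h; apply/val_inj/comp_lfunDl. Qed.
Fact end_mulDr : right_distributive end_mul +%R.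
Proof. by move=> f g h; apply/val_inj/comp_lfunDr. Qed.
Fact end_one_neq0 : end_one != 0.
Proof.
apply/eqP => /(congr1 val)/= /lfunP one0; apply: nzM.
apply/eqP; rewrite -subv0; apply/subvP => v _; rewrite memv0.
by have := one0 v; rewrite id_lfunE zero_lfunE => ->.
Qed.
HB.instance Definition _ := GRing.Zmodule_isNzRing.Build E
  end_mulA end_mul1 end_mulr1 end_mulDl end_mulDr end_one_neq0.

Fact end_scalerAl (a : K) (f g : E) : a *: (f * g) = (a *: f) * g.
Proof. by apply/val_inj; rewrite /= comp_lfunZl. Qed.
HB.instance Definition _ := GRing.Lmodule_isLalgebra.Build K E end_scalerAl.
Fact end_scalerAr (a : K) (f g : E) : a *: (f * g) = f * (a *: g).
Proof. by apply/val_inj; rewrite /= comp_lfunZr. Qed.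
HB.instance Definition _ := GRing.Lalgebra_isAlgebra.Build K E end_scalerAr.
HB.instance Definition _ := Algebra_isFalgebra.Build K E.
End Ring.
End EndomorphismAlgebra.

Section SpecialModule.
Variables (K : fieldType) (n w r : nat) (x : 'I_r -> 'I_n.+1).
Local Notation A := (cycalg K n w).

(* The sum of all e_i A and of the e_(x_j) A / e_(x_j) J^w, where w + 1 is the
   Loewy length of A. *)
Definition special_mod : rmod A :=
  dsum (\big[@dsum K A/zeromod]_(i < n.+1) emod (cyc_idem K w i))
       (\big[@dsum K A/zeromod]_(j < r)
          equot (cyc_idem K w (x j)) (cyc_rad K n w ^+ w)%VS).

Fact dsum_nz (M N : rmod A) : {:M}%VS <> 0%VS -> {:dsum M N}%VS <> 0%VS.
Proof.
move=> nzM MN0; apply: nzM; apply/eqP; rewrite -subv0; apply/subvP => v _.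
have : ((v, 0) : dsum M N) \in (0%VS : {vspace dsum M N}) by rewrite -MN0 memvf.
by rewrite !memv0 => /eqP/(congr1 fst)/= ->.
Qed.

Fact special_mod_nz : {:special_mod}%VS <> 0%VS.
Proof.
apply: dsum_nz; rewrite big_ord_recl; apply: dsum_nz.
set e := cyc_idem K w ord0 => eA0.
have eeA : e * 1 \in (<[e]> * fullv)%VS by rewrite memv_mul ?memv_line ?memvf.
have /eqP/(congr1 val)/= : (Subvs eeA : emod e) == 0 by rewrite -memv0 -eA0 memvf.
rewrite mulr1 => /ffunP/(_ (ord0, ord0)); rewrite !ffunE /= => /eqP.
by rewrite oner_eq0.
Qed.

End SpecialModule.

Arguments special_mod K {n} w {r} x.
Arguments special_mod_nz K {n} w {r} x.

(* Directed distances in the oriented cycle Z/(n+1); paths have length >= 1. *)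
Section Distances.
Variables (n r : nat) (x : 'I_r -> 'I_n.+1).

Definition reaches (i : 'I_r) : pred nat :=
  fun b => (0 < b)%N && [exists j, x i + b == x j %[mod n.+1]].

Fact reaches_ex i : exists b, reaches i b.
Proof. by exists n.+1; apply/existsP; exists i; rewrite modnDr. Qed.

Definition next_dist (i : 'I_r) : nat := ex_minn (reaches_ex i).

Fact reaches_any_ex : (0 < r)%N -> exists s, [exists i, reaches i s].
Proof.
move=> r_gt0; exists n.+1; apply/existsP; exists (Ordinal r_gt0).
by apply/existsP; exists (Ordinal r_gt0); rewrite modnDr.
Qed.

Definition min_dist (r_gt0 : (0 < r)%N) : nat := ex_minn (reaches_any_ex r_gt0).

Definition max_next_dist : nat := \max_(i < r) next_dist i.

End Distances.

(* Main.v *)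
Require Import Defs.
From HB Require Import structures.
From mathcomp Require Import all_boot all_order all_algebra all_field.
From mathcomp Require Import zify.

Set Implicit Arguments.
Unset Strict Implicit.
Unset Printing Implicit Defensive.

Import GRing.Theory.

Local Open Scope ring_scope.

(** The summands of the special module [M] sit on a cycle: the projective
    [e_i A] in the order of the vertices of [A], and the module
    [e_x A / e_x J^w] of a special point [x] just before [e_x A]. Every map
    between summands is a combination of composites of the maps between
    neighbours on this cycle, so [B] is again given by an oriented cycle, with
    [n + 1 + r] vertices ([special_pres]). Since [n + 1] divides [w], the path
    that winds [w / (n + 1)] times around the new cycle, of length [T] say, is
    closed. The projective module at an ordinary vertex [inl i] has length
    [T + 1] and the one at a special vertex [inr j] has length [T]. That [B] is
    a Nakayama algebra follows from its shape alone ([pres_nakayama]).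

    All modules that matter are chains: uniserial modules given by their top
    vertex and their length, with an evident universal property. A chain is
    injective when no path of its length ends at its socle ([chain_injective]).
    Hence the projective modules of length [T + 1] are injective, while the one
    of length [T] at a special vertex is not. Its minimal coresolution consists
    of modules of length [T + 1]: two of them for each ordinary vertex met on
    the way back to the preceding special vertex. There the coresolution ends
    with a module of length [T] that is injective but not projective
    ([profile_short]). So the projective module at the special vertex that
    follows [x_j] has a coresolution of length twice the distance from [x_j] to
    the next special point, and only its last term fails to be projective.

    The regular module is the direct sum of these projectives
    ([regmod_profile]): its coresolution meets a nonprojective term first at
    twice the smallest of these distances, and ends at twice the largest one.
    The smallest distance is also the least distance between any two special
    points ([min_distP]). A minimal coresolution is in each degree a direct
    summand of any other one ([min_cores_summand]), so the two dimensions can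
    be read off from this single coresolution. *)

Local Notation "y ** a" := (ract y a) (at level 40, left associativity).

(** * Modules and homomorphisms *)

Section Actions.
Variables (K : fieldType) (B : falgType K) (M : rmod B).
Implicit Types (y z : M) (a b : B).

HB.instance Definition _ y :=
  GRing.isLinear.Build K B M _ (@ract K B M y) (@ract_linearr K B M y).

Definition actr y : 'Hom(B, M) := linfun (ract y).

Lemma actrE y a : actr y a = y ** a. Proof. exact: lfunE. Qed.

Lemma ract_lfunE a y : ract_lfun M a y = y ** a. Proof. exact: lfunE. Qed.

Lemma actDl y z a : (y + z) ** a = y ** a + z ** a.
Proof. by rewrite -!ract_lfunE linearD. Qed.

Lemma actBl y z a : (y - z) ** a = y ** a - z ** a.
Proof. by rewrite -!ract_lfunE linearB. Qed.

Lemma actZl (k : K) y a : (k *: y) ** a = k *: (y ** a).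
Proof. by rewrite -!ract_lfunE linearZ. Qed.

Lemma act0l a : (0 : M) ** a = 0.
Proof. by rewrite -ract_lfunE linear0. Qed.

Lemma actr0 y : y ** 0 = 0.
Proof. by rewrite -actrE linear0. Qed.

Lemma act_suml I (r : seq I) (P : pred I) (F : I -> M) a :
  (\sum_(i <- r | P i) F i) ** a = \sum_(i <- r | P i) F i ** a.
Proof.
by rewrite -ract_lfunE linear_sum; apply: eq_bigr => i _; apply: ract_lfunE.
Qed.

End Actions.

Section Homs.
Variables (K : fieldType) (B : falgType K).
Implicit Types (M N P E X Y : rmod B).

Lemma is_hom_comp M N P (g : 'Hom(N, P)) (f : 'Hom(M, N)) :
  is_hom g -> is_hom f -> is_hom (g \o f)%VF.
Proof. by move=> hg hf v a; rewrite !comp_lfunE hf hg. Qed.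

Lemma is_hom_id M : is_hom (\1%VF : 'End(M)).
Proof. by move=> v a; rewrite !id_lfunE. Qed.

Lemma is_hom0 M N : is_hom (0 : 'Hom(M, N)).
Proof. by move=> v a; rewrite !zero_lfunE act0l. Qed.

Lemma is_hom_inv M N (f : 'Hom(M, N)) :
  is_hom f -> lker f = 0%VS -> limg f = fullv -> is_hom (f^-1)%VF.
Proof.
move=> hf /eqP kf fullf v a; have fK u : f (f^-1%VF u) = u.
  by apply: limg_lfunVK; rewrite fullf memvf.
have injf : injective f by apply/lker0P.
by apply: injf; rewrite fK hf fK.
Qed.

Lemma lker_submodule M N (f : 'Hom(M, N)) : is_hom f -> submodule (lker f).
Proof. by move=> hf v a; rewrite !memv_ker hf => /eqP->; rewrite act0l. Qed.

Lemma limg_submodule M N (f : 'Hom(M, N)) : is_hom f -> submodule (limg f).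
Proof.
by move=> hf _ a /memv_imgP[u _ ->]; rewrite -hf memv_img ?memvf.
Qed.

Lemma full_mem (V : vectType K) (U : {vspace V}) :
  (forall v, v \in U) -> U = fullv.
Proof. by move=> h; apply/vspaceP => v; rewrite h memvf. Qed.

Lemma zero_mem (V : vectType K) (U : {vspace V}) :
  (forall v, v \in U -> v = 0) -> U = 0%VS.
Proof.
move=> h; apply/vspaceP => v; rewrite memv0; apply/idP/eqP => [/h // | ->].
exact: mem0v.
Qed.

Lemma mem_zero (V : vectType K) (U : {vspace V}) v : U = 0%VS -> v \in U -> v = 0.
Proof. by move=> ->; rewrite memv0 => /eqP. Qed.

Lemma inj_full M (f : 'End(M)) : lker f = 0%VS -> limg f = fullv.
Proof. by move=> /eqP kf; apply: lker0_limgf. Qed.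

Lemma full_ker0 M (f : 'End(M)) : limg f = fullv -> lker f = 0%VS.
Proof.
move=> ff; apply/eqP; rewrite -dimv_eq0.
have := limg_ker_dim f fullv; rewrite ff capfv => /eqP.
by rewrite -[X in _ == X]add0n eqn_add2r.
Qed.

(** The inverse of [g] on its image is only linear; what it lacks to be a
   homomorphism lies in the kernel of [g], which [f] kills. *)
Lemma injective_factor M N E (g : 'Hom(M, N)) (f : 'Hom(M, E)) :
  injective_mod E -> is_hom g -> is_hom f -> (lker g <= lker f)%VS ->
  exists h : 'Hom(N, E), is_hom h /\ (h \o g)%VF = f.
Proof.
move=> injE hg hf kgf.
pose S := submod (limg_submodule hg).
pose inc : 'Hom(S, N) := linfun (vsval : S -> N).
have incE u : inc u = vsval u by rewrite lfunE.
have gV y : y \in limg g -> g (g^-1%VF y) = y by move=> yg; apply: limg_lfunVK.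
pose f' : 'Hom(S, E) := ((f \o g^-1) \o inc)%VF.
have f'E (u : M) (gu : g u \in limg g) : f' (Subvs gu) = f u.
  rewrite !comp_lfunE incE /=; apply/eqP; rewrite -subr_eq0 -linearB -memv_ker.
  by apply: (subvP kgf); rewrite memv_ker linearB /= gV // subrr.
have hinc : is_hom inc by move=> v a; rewrite !incE.
have kinc : lker inc = 0%VS.
  by apply: zero_mem => v; rewrite memv_ker incE => /eqP v0; apply: val_inj.
have hf' : is_hom f'.
  move=> v a; have [u _ vu] := memv_imgP (subvsP v).
  have gu : g u \in limg g by rewrite memv_img ?memvf.
  have gua : g (u ** a) \in limg g by rewrite memv_img ?memvf.
  have -> : v = Subvs gu by apply: val_inj.
  have -> : (Subvs gu : S) ** a = Subvs gua by apply: val_inj; rewrite /= hg.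
  by rewrite !f'E hf.
have [h [hh hE]] := injE _ _ _ f' hinc kinc hf'.
exists h; split=> //; apply/lfunP => u; rewrite comp_lfunE.
have gu : g u \in limg g by rewrite memv_img ?memvf.
by rewrite -(f'E u gu) -hE comp_lfunE incE.
Qed.

Lemma projective_retract P X (i : 'Hom(X, P)) (p : 'Hom(P, X)) :
  is_hom i -> is_hom p -> lker (p \o i)%VF = 0%VS -> projective P -> projective X.
Proof.
move=> hi hp kpi projP.
have hpi : is_hom (p \o i)%VF by apply: is_hom_comp.
have fpi := inj_full kpi.
have hq := is_hom_inv hpi kpi fpi.
move=> M N g f hg gfull hf.
have [h [hh hE]] := projP M N g _ hg gfull (is_hom_comp hf (is_hom_comp hq hp)).
exists (h \o i)%VF; split; first exact: is_hom_comp.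
rewrite comp_lfunA hE; apply/lfunP => x; rewrite !comp_lfunE.
rewrite -[p (i x)](comp_lfunE p i) lker0_lfunK //; exact/eqP.
Qed.

Lemma zero_hom M N (f : 'Hom(M, N)) : {:M}%VS = 0%VS -> f = 0.
Proof.
move=> M0; apply/lfunP => v.
by rewrite (mem_zero M0 (memvf v)) !linear0.
Qed.

Lemma zeromod0 : {:zeromod : rmod B}%VS = 0%VS.
Proof.
apply: zero_mem => v _; apply: val_inj => /=.
by apply: mem_zero (subvsP v).
Qed.

Lemma zero_projective M : {:M}%VS = 0%VS -> projective M.
Proof.
move=> M0 X Y g f hg _ hf; exists 0; split; first exact: is_hom0.
by rewrite (zero_hom f M0) comp_lfun0r.
Qed.

Lemma zero_injective M : {:M}%VS = 0%VS -> injective_mod M.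
Proof.
move=> M0 X Y g f hg _ hf; exists 0; split; first exact: is_hom0.
apply/lfunP => v; rewrite comp_lfunE !zero_lfunE.
by rewrite (mem_zero M0 (memvf (f v))).
Qed.

(** ** Direct sums *)

Section DirectSum.
Variables M N : rmod B.

Definition dsum_inl (v : M) : dsum M N := (v, 0).
Definition dsum_inr (v : N) : dsum M N := (0, v).
Definition dsum_fst (v : dsum M N) : M := v.1.
Definition dsum_snd (v : dsum M N) : N := v.2.

Fact dsum_inl_linear : linear dsum_inl.
Proof. by move=> k u v; apply/pair_equal_spec; rewrite /= scaler0 addr0. Qed.
Fact dsum_inr_linear : linear dsum_inr.
Proof. by move=> k u v; apply/pair_equal_spec; rewrite /= scaler0 addr0. Qed.
HB.instance Definition _ := GRing.isLinear.Build K M (dsum M N) _ dsum_inl dsum_inl_linear.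
HB.instance Definition _ := GRing.isLinear.Build K N (dsum M N) _ dsum_inr dsum_inr_linear.
HB.instance Definition _ := GRing.isLinear.Build K (dsum M N) M _ dsum_fst
  (fun k u v => erefl).
HB.instance Definition _ := GRing.isLinear.Build K (dsum M N) N _ dsum_snd
  (fun k u v => erefl).

Definition inl_hom : 'Hom(M, dsum M N) := linfun dsum_inl.
Definition inr_hom : 'Hom(N, dsum M N) := linfun dsum_inr.
Definition fst_hom : 'Hom(dsum M N, M) := linfun dsum_fst.
Definition snd_hom : 'Hom(dsum M N, N) := linfun dsum_snd.

Lemma inl_homE v : inl_hom v = (v, 0). Proof. exact: lfunE. Qed.
Lemma inr_homE v : inr_hom v = (0, v). Proof. exact: lfunE. Qed.
Lemma fst_homE v : fst_hom v = v.1. Proof. exact: lfunE. Qed.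
Lemma snd_homE v : snd_hom v = v.2. Proof. exact: lfunE. Qed.

Lemma inl_is_hom : is_hom inl_hom.
Proof. by move=> v a; rewrite !inl_homE /= /dsum_act /= act0l. Qed.
Lemma inr_is_hom : is_hom inr_hom.
Proof. by move=> v a; rewrite !inr_homE /= /dsum_act /= act0l. Qed.
Lemma fst_is_hom : is_hom fst_hom.
Proof. by move=> v a; rewrite !fst_homE. Qed.
Lemma snd_is_hom : is_hom snd_hom.
Proof. by move=> v a; rewrite !snd_homE. Qed.

Lemma dsum_eta (v : dsum M N) : v = inl_hom v.1 + inr_hom v.2.
Proof.
rewrite inl_homE inr_homE; case: v => v1 v2.
by apply/pair_equal_spec; rewrite /= addr0 add0r.
Qed.

End DirectSum.

Lemma dsum_homP M N X (f : 'Hom(M, X)) (g : 'Hom(N, X)) : is_hom f -> is_hom g ->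
  exists h : 'Hom(dsum M N, X), is_hom h /\ forall v, h v = f v.1 + g v.2.
Proof.
move=> hf hg; exists ((f \o fst_hom M N) + (g \o snd_hom M N))%VF.
have E v : ((f \o fst_hom M N) + (g \o snd_hom M N))%VF v = f v.1 + g v.2.
  by rewrite add_lfunE !comp_lfunE fst_homE snd_homE.
by split=> // v a; rewrite !E /= hf hg -actDl.
Qed.

Definition dsum_map M N X Y (f : 'Hom(M, X)) (g : 'Hom(N, Y)) :
    'Hom(dsum M N, dsum X Y) :=
  (((inl_hom X Y \o f) \o fst_hom M N) + ((inr_hom X Y \o g) \o snd_hom M N))%VF.

Lemma dsum_mapE M N X Y (f : 'Hom(M, X)) (g : 'Hom(N, Y)) v :
  dsum_map f g v = (f v.1, g v.2).
Proof.
rewrite add_lfunE !comp_lfunE fst_homE snd_homE inl_homE inr_homE.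
by apply/pair_equal_spec; rewrite /= addr0 add0r.
Qed.

Lemma dsum_map_hom M N X Y (f : 'Hom(M, X)) (g : 'Hom(N, Y)) :
  is_hom f -> is_hom g -> is_hom (dsum_map f g).
Proof. by move=> hf hg v a; rewrite !dsum_mapE /= /dsum_act /= hf hg. Qed.

Lemma mem_limg (V W : vectType K) (f : 'Hom(V, W)) v : reflect (exists u, v = f u) (v \in limg f).
Proof.
apply: (iffP memv_imgP) => [[u _ ->]|[u ->]]; first by exists u.
by exists u; rewrite ?memvf.
Qed.

Lemma mem_limg_dsum M N X Y (f : 'Hom(M, X)) (g : 'Hom(N, Y)) v :
  (v \in limg (dsum_map f g)) = (v.1 \in limg f) && (v.2 \in limg g).
Proof.
apply/mem_limg/andP => [[u ->]|[/mem_limg[u uE] /mem_limg[u' u'E]]].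
  by rewrite dsum_mapE !memv_img ?memvf.
by exists (u, u'); rewrite dsum_mapE -uE -u'E; case: v {uE u'E}.
Qed.

Lemma mem_lker_dsum M N X Y (f : 'Hom(M, X)) (g : 'Hom(N, Y)) v :
  (v \in lker (dsum_map f g)) = (v.1 \in lker f) && (v.2 \in lker g).
Proof. by rewrite !memv_ker dsum_mapE. Qed.

Lemma dsum_zero M N : {:M}%VS = 0%VS -> {:N}%VS = 0%VS -> {:dsum M N}%VS = 0%VS.
Proof.
move=> M0 N0; apply: zero_mem => -[u v] _.
by rewrite (mem_zero M0 (memvf u)) (mem_zero N0 (memvf v)).
Qed.

Lemma dsum_injective M N : injective_mod M -> injective_mod N -> injective_mod (dsum M N).
Proof.
move=> iM iN X Y g f hg kg hf.
have [h1 [hh1 E1]] := iM _ _ g _ hg kg (is_hom_comp (@fst_is_hom M N) hf).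
have [h2 [hh2 E2]] := iN _ _ g _ hg kg (is_hom_comp (@snd_is_hom M N) hf).
exists ((inl_hom M N \o h1) + (inr_hom M N \o h2))%VF; split.
  move=> v a; rewrite !add_lfunE !comp_lfunE hh1 hh2 inl_is_hom inr_is_hom.
  by rewrite actDl.
apply/lfunP => v; rewrite comp_lfunE add_lfunE !comp_lfunE.
have -> : h1 (g v) = (f v).1 by rewrite -[LHS]comp_lfunE E1 comp_lfunE fst_homE.
have -> : h2 (g v) = (f v).2 by rewrite -[LHS]comp_lfunE E2 comp_lfunE snd_homE.
by rewrite -dsum_eta.
Qed.

Lemma dsum_projective M N :
  projective (dsum M N) <-> projective M /\ projective N.
Proof.
split=> [pMN|[pM pN]].
  split.
    apply: (projective_retract (@inl_is_hom M N) (@fst_is_hom M N)) => //.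
    by apply: zero_mem => v; rewrite memv_ker comp_lfunE inl_homE fst_homE => /eqP.
  apply: (projective_retract (@inr_is_hom M N) (@snd_is_hom M N)) => //.
  by apply: zero_mem => v; rewrite memv_ker comp_lfunE inr_homE snd_homE => /eqP.
move=> X Y g f hg gfull hf.
have [h1 [hh1 E1]] := pM _ _ g _ hg gfull (is_hom_comp hf (@inl_is_hom M N)).
have [h2 [hh2 E2]] := pN _ _ g _ hg gfull (is_hom_comp hf (@inr_is_hom M N)).
have [h [hh hE]] := dsum_homP hh1 hh2; exists h; split=> //.
apply/lfunP => v; rewrite comp_lfunE hE linearD /= [in RHS](dsum_eta v) linearD /=.
by rewrite -(comp_lfunE g h1) E1 -(comp_lfunE g h2) E2 !comp_lfunE.
Qed.

(** ** Essential submodules *)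

Fact cyclic_submodule M (y : M) : submodule (limg (actr y)).
Proof.
move=> _ a /mem_limg[b ->]; apply/mem_limg; exists (b * a).
by rewrite !actrE ractM.
Qed.

(** It suffices to test essentiality on the cyclic submodules. *)
Lemma essentialP E (U : {vspace E}) :
  essential U <-> forall y, y <> 0 -> exists a, y ** a \in U /\ y ** a <> 0.
Proof.
split=> [essU y y0|essU V sV V0 UV0].
  have yV : y \in limg (actr y) by apply/mem_limg; exists 1; rewrite actrE ract1.
  have nz : (U :&: limg (actr y))%VS != 0%VS.
    apply/eqP/essU; first exact: cyclic_submodule.
    by move=> V0; apply: y0; apply: mem_zero yV.
  move: (memv_pick (U :&: limg (actr y))); rewrite memv_cap => /andP[pU].
  case/mem_limg => a; rewrite actrE => pE.
  by exists a; rewrite -pE; split=> //; apply/eqP; rewrite vpick0.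
have V0' : vpick V <> 0 by apply/eqP; rewrite vpick0; apply/eqP.
have [a [aU]] := essU _ V0'; apply; apply: mem_zero UV0 _.
by rewrite memv_cap aU sV ?memv_pick.
Qed.

(** Move the first component into its essential submodule, then the second
    one: the first stays there, since that submodule is stable. *)
Lemma dsum_essential M N X Y (f : 'Hom(M, X)) (g : 'Hom(N, Y)) :
  is_hom f -> is_hom g -> essential (limg f) -> essential (limg g) ->
  essential (limg (dsum_map f g)).
Proof.
move=> hf hg /essentialP ef /essentialP eg; apply/essentialP => -[y z] yz.
have sf := limg_submodule hf; have sg := limg_submodule hg.
have step1 : exists a, y ** a \in limg f /\ ((y, z) : dsum X Y) ** a <> 0.
  have [y0|/eqP y0] := eqVneq y 0.
    by exists 1; rewrite y0 act0l mem0v; split=> //; rewrite -y0 ract1.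
  by have [a [aU a0]] := ef y y0; exists a; split=> // -[].
case: step1 => a [yaf]; have [za0|/eqP za0] := eqVneq (z ** a) 0.
  by move=> nz; exists a; rewrite mem_limg_dsum /= yaf za0 mem0v.
have [b [bU b0]] := eg _ za0; move=> _; exists (a * b).
rewrite mem_limg_dsum /= !ractM bU sf //; split=> //; move/(congr1 snd) => /= E.
by apply: b0; rewrite -E ?ractM.
Qed.

End Homs.

(** * Injective coresolutions *)

Section Coresolutions.
Variables (K : fieldType) (B : falgType K).
Implicit Types (E X Y : rmod B) (P Z : nat -> Prop).

Lemma subv_mem (V : vectType K) (U W : {vspace V}) :
  (forall v, v \in U -> v \in W) -> (U <= W)%VS.
Proof. by move=> h; apply/subvP. Qed.

(** Both [h] and [g] extend along [p] and [p']. The automorphism [g \o h] maps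
    the kernel of [p] onto itself, by dimension, hence the composite of the
    extensions is injective on the image of [p]; as this image is essential, it
    is injective everywhere. *)
Lemma comparison_step (P P' : rmod B) E E' (p : 'Hom(P, E)) (p' : 'Hom(P', E'))
    (h : 'Hom(P, P')) (g : 'Hom(P', P)) :
  injective_mod E -> injective_mod E' -> is_hom p -> is_hom p' ->
  essential (limg p) -> is_hom h -> is_hom g ->
  (forall v, v \in lker p -> h v \in lker p') ->
  (forall v, v \in lker p' -> g v \in lker p) ->
  lker (g \o h)%VF = 0%VS ->
  exists (h' : 'Hom(E, E')) (g' : 'Hom(E', E)),
    [/\ is_hom h', is_hom g', (h' \o p = p' \o h)%VF, (g' \o p' = p \o g)%VF &
        lker (g' \o h')%VF = 0%VS].
Proof.
move=> iE iE' hp hp' ess hh hg hker gker kgh.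
have [h' [hh' h'E]] : exists h' : 'Hom(E, E'), is_hom h' /\ (h' \o p = p' \o h)%VF.
  apply: injective_factor => //; first exact: is_hom_comp.
  by apply: subv_mem => v /hker; rewrite !memv_ker comp_lfunE.
have [g' [hg' g'E]] : exists g' : 'Hom(E', E), is_hom g' /\ (g' \o p' = p \o g)%VF.
  apply: injective_factor => //; first exact: is_hom_comp.
  by apply: subv_mem => v /gker; rewrite !memv_ker comp_lfunE.
exists h', g'; split=> //.
have hgh : is_hom (g' \o h')%VF by apply: is_hom_comp.
have comm v : (g' \o h')%VF (p v) = p ((g \o h)%VF v).
  by rewrite -comp_lfunE -comp_lfunA h'E comp_lfunA g'E !comp_lfunE.
have kp : ((g \o h) @: lker p = lker p)%VS.
  apply/eqP; rewrite eqEdim limg_dim_eq ?leqnn ?andbT; last by rewrite kgh capv0.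
  apply: subv_mem => _ /memv_imgP[v vp ->].
  by rewrite comp_lfunE gker ?hker.
have [->//|/eqP nz] := eqVneq (lker (g' \o h')%VF) 0%VS.
case: (ess _ (lker_submodule hgh) nz); apply: zero_mem => y.
rewrite memv_cap => /andP[/mem_limg[v ->]]; rewrite memv_ker comm => pv0.
have : (g \o h)%VF v \in lker p by rewrite memv_ker.
rewrite -kp => /memv_imgP[u up uv].
have /lker0P inj : lker (g \o h)%VF == 0%VS by apply/eqP.
by move: up; rewrite -(inj _ _ uv) memv_ker => /eqP.
Qed.

(** A minimal coresolution is, degree by degree, a direct summand of every
    other one. The maps are carried along by induction, together with the sole
    fact that they respect the kernels of the differentials. *)
Lemma min_cores_summand X (I I' : nat -> rmod B)
    (eps : 'Hom(X, I 0)) (d : forall i, 'Hom(I i, I i.+1))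
    (eps' : 'Hom(X, I' 0)) (d' : forall i, 'Hom(I' i, I' i.+1)) :
  min_inj_cores eps d -> inj_cores eps' d' ->
  forall k, exists (h : 'Hom(I k, I' k)) (g : 'Hom(I' k, I k)),
    [/\ is_hom h, is_hom g & lker (g \o h)%VF = 0%VS].
Proof.
move=> [[injI [heps hd] keps exeps exd] ess0 ess].
move=> [injI' [heps' hd'] keps' exeps' exd'] k.
suff [h [g [hh hg _ _ kgh]]] :
    exists (h : 'Hom(I k, I' k)) (g : 'Hom(I' k, I k)),
    [/\ is_hom h, is_hom g, forall v, v \in lker (d k) -> h v \in lker (d' k),
        forall v, v \in lker (d' k) -> g v \in lker (d k) &
        lker (g \o h)%VF = 0%VS] by exists h, g.
elim: k => [|k [h [g [hh hg hker gker kgh]]]].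
  have [|||h [g [hh hg hE gE kgh]]] := @comparison_step X X (I 0) (I' 0)
    eps eps' \1%VF \1%VF (injI 0) (injI' 0) heps heps' ess0
    (@is_hom_id _ _ _) (@is_hom_id _ _ _).
  - by move=> v; rewrite keps => /mem_zero->//; rewrite linear0 mem0v.
  - by move=> v; rewrite keps' => /mem_zero->//; rewrite linear0 mem0v.
  - by apply: zero_mem => v; rewrite memv_ker comp_lfunE !id_lfunE => /eqP.
  exists h, g; split=> // v; rewrite -?exeps -?exeps' => /mem_limg[u ->].
    by rewrite -comp_lfunE hE comp_lfunE id_lfunE memv_img ?memvf.
  by rewrite -comp_lfunE gE comp_lfunE id_lfunE memv_img ?memvf.
have [h' [g' [hh' hg' hE gE kgh']]] := comparison_step (injI _) (injI' _)
  (hd k) (hd' k) (ess k) hh hg hker gker kgh.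
exists h', g'; split=> // v; rewrite -exd -exd' => /mem_limg[u ->].
  by rewrite -comp_lfunE hE comp_lfunE memv_img ?memvf.
by rewrite -comp_lfunE gE comp_lfunE memv_img ?memvf.
Qed.

Lemma min_cores_projective X (I I' : nat -> rmod B)
    (eps : 'Hom(X, I 0)) (d : forall i, 'Hom(I i, I i.+1))
    (eps' : 'Hom(X, I' 0)) (d' : forall i, 'Hom(I' i, I' i.+1)) k :
  min_inj_cores eps d -> inj_cores eps' d' -> projective (I' k) -> projective (I k).
Proof.
move=> mI cI; have [h [g [hh hg kgh]]] := min_cores_summand mI cI k.
exact: projective_retract kgh.
Qed.

(** All that the dominant dimension and the injective dimension need to know
    about a minimal injective coresolution: which terms are projective ([P]),
    and enough terms that vanish ([Z]). *)
Definition has_profile X (P Z : nat -> Prop) : Prop :=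
  exists (I : nat -> rmod B) (eps : 'Hom(X, I 0)) (d : forall i, 'Hom(I i, I i.+1)),
    [/\ min_inj_cores eps d, forall k, projective (I k) <-> P k &
        forall k, Z k -> {:I k}%VS = 0%VS].

Lemma profile_ext X (P P' Z Z' : nat -> Prop) :
  (forall k, P k <-> P' k) -> (forall k, Z' k -> Z k) ->
  has_profile X P Z -> has_profile X P' Z'.
Proof.
move=> PE ZE [I [eps [d [mI pI zI]]]]; exists I, eps, d; split=> // k; last by move/ZE/zI.
by split=> [/pI/PE|/PE/pI].
Qed.

Definition cons_mod X (I : nat -> rmod B) k : rmod B :=
  if k is k'.+1 then I k' else X.

Definition cons_diff X (I : nat -> rmod B) (f : 'Hom(X, I 0))
    (d : forall i, 'Hom(I i, I i.+1)) k :
    'Hom(cons_mod X I k, cons_mod X I k.+1) :=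
  if k is k'.+1 then d k' else f.

Definition cons_prop (b : Prop) (P : nat -> Prop) k : Prop :=
  if k is k'.+1 then P k' else b.

(** Splicing the coresolution of the cokernel [Y] to the embedding of [X] in
    its injective hull [E]. *)
Lemma profile_cons X E Y (f : 'Hom(X, E)) (g : 'Hom(E, Y)) (b : Prop) P Z :
  is_hom f -> is_hom g -> lker f = 0%VS -> limg f = lker g -> limg g = fullv ->
  injective_mod E -> essential (limg f) -> (projective E <-> b) ->
  has_profile Y P Z -> has_profile X (cons_prop b P) (cons_prop False Z).
Proof.
move=> hf hg kf fg gfull iE ess pE [I [eps [d [mI pI zI]]]].
have [[injI [heps hd] keps exeps exd] ess0 essd] := mI.
have kege : lker (eps \o g)%VF = limg f.
  rewrite fg; apply/vspaceP => v; rewrite !memv_ker comp_lfunE.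
  apply/eqP/eqP => [/eqP|->]; last by rewrite linear0.
  by rewrite -memv_ker keps memv0 => /eqP.
have iege : limg (eps \o g)%VF = limg eps by rewrite limg_comp gfull.
exists (cons_mod E I), f, (cons_diff (eps \o g)%VF d); split.
- split=> //; first split=> //; first by case.
  + by split=> // -[|k] //=; apply: is_hom_comp.
  + by case=> [|k] //=; rewrite iege.
  + by case=> [|k] //=; rewrite iege.
- by case.
- by case.
Qed.

Lemma profile_zero : has_profile (zeromod : rmod B) (fun=> True) (fun=> True).
Proof.
have z0 := @zeromod0 K B; exists (fun=> zeromod), \1%VF, (fun=> 0).
have k1 : lker (\1%VF : 'End(zeromod : rmod B)) = 0%VS.
  by apply: zero_mem => v; rewrite memv_ker id_lfunE => /eqP.
have all0 (U U' : {vspace (zeromod : rmod B)}) : U = U'.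
  by apply/vspaceP => v; rewrite (mem_zero z0 (memvf v)) !mem0v.
split=> //; last by move=> k; split=> // _; apply: zero_projective.
split; last 2 first.
- by move=> V _ []; apply: all0.
- by move=> i V _ []; apply: all0.
split=> //; first by move=> _; apply: zero_injective.
by split=> [|_]; [apply: is_hom_id | apply: is_hom0].
Qed.

Lemma profile_injective X (b : Prop) : injective_mod X -> (projective X <-> b) ->
  has_profile X (cons_prop b (fun=> True)) (cons_prop False (fun=> True)).
Proof.
move=> iX pX; have z0 := @zeromod0 K B.
apply: (@profile_cons X X zeromod \1%VF 0) => //.
- exact: is_hom_id.
- exact: is_hom0.
- by apply: zero_mem => v; rewrite memv_ker id_lfunE => /eqP.
- rewrite lim1g; apply/esym/full_mem => v; by rewrite memv_ker zero_lfunE.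
- by apply: full_mem => v; rewrite (mem_zero z0 (memvf v)) mem0v.
- rewrite lim1g => V _ V0; by rewrite capfv.
exact: profile_zero.
Qed.

Lemma profile_dsum X Y P Z P' Z' : has_profile X P Z -> has_profile Y P' Z' ->
  has_profile (dsum X Y) (fun k => P k /\ P' k) (fun k => Z k /\ Z' k).
Proof.
move=> [I [eps [d [mI pI zI]]]] [I' [eps' [d' [mI' pI' zI']]]].
have [[injI [heps hd] keps exeps exd] ess0 ess] := mI.
have [[injI' [heps' hd'] keps' exeps' exd'] ess0' ess'] := mI'.
exists (fun k => dsum (I k) (I' k)), (dsum_map eps eps'),
  (fun k => dsum_map (d k) (d' k)); split.
- split; last 2 first.
  + exact: dsum_essential.
  + by move=> i; apply: dsum_essential.
  split.
  + by move=> i; apply: dsum_injective.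
  + by split=> [|i]; apply: dsum_map_hom.
  + apply: zero_mem => -[u v]; rewrite mem_lker_dsum keps keps' !memv0 /=.
    by case/andP=> /eqP-> /eqP->.
  + by apply/vspaceP => v; rewrite mem_lker_dsum mem_limg_dsum exeps exeps'.
  + by move=> i; apply/vspaceP => v; rewrite mem_lker_dsum mem_limg_dsum exd exd'.
- move=> k; split=> [/dsum_projective[/pI ? /pI' ?]|[/pI ? /pI' ?]]; first by split.
  exact/dsum_projective.
- by move=> k [/zI I0 /zI' I0']; apply: dsum_zero.
Qed.

Lemma profile_iso X Y P Z : isomorphic X Y -> has_profile Y P Z -> has_profile X P Z.
Proof.
case=> f [hf kf ff] [I [eps [d [mI pI zI]]]].
have [[injI [heps hd] keps exeps exd] ess0 ess] := mI.
have fe : limg (eps \o f)%VF = limg eps by rewrite limg_comp ff.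
exists I, (eps \o f)%VF, d; split=> //; split; rewrite ?fe //.
split; rewrite ?fe //; first by split=> //; apply: is_hom_comp.
apply: zero_mem => v; rewrite memv_ker comp_lfunE -memv_ker keps memv0 -memv_ker.
by rewrite kf memv0 => /eqP.
Qed.

Lemma profile_bigdsum m (X : 'I_m -> rmod B) (P Z : 'I_m -> nat -> Prop) :
  (forall i, has_profile (X i) (P i) (Z i)) ->
  has_profile (\big[@dsum K B/zeromod]_(i < m) X i)
    (fun k => forall i, P i k) (fun k => forall i, Z i k).
Proof.
elim: m X P Z => [|m IHm] X P Z pX.
  rewrite big_ord0; apply: profile_ext profile_zero => // k.
  by split=> // _ [].
rewrite big_ord_recl.
apply: profile_ext (profile_dsum (pX ord0) (IHm _ _ _ (fun i => pX (lift ord0 i)))).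
- move=> k; split=> [[P0 PS] i|Pk]; last by split.
  by case: (unliftP ord0 i) => [j|] ->.
- by move=> k Zk; split.
Qed.

(** ** Dominant dimension and injective dimension from a profile *)

Lemma profile_domdim P Z m :
  has_profile (regmod B) P Z -> (forall k, (k <= m)%N -> P k) -> ~ P m.+1 ->
  is_domdim B m.+1.
Proof.
move=> [I [eps [d [mI pI zI]]]] Pm nP; split; first by exists I, eps, d.
move=> I' eps' d' mI'.
have cI : inj_cores eps d by case: mI.
have cI' : inj_cores eps' d' by case: mI'.
have pI' k : projective (I' k) <-> P k.
  split=> [p|/pI]; last exact: (min_cores_projective mI' cI).
  exact/pI/(min_cores_projective mI cI').
split; first by apply/pI'/Pm.
split=> [i im|k pk]; first by apply/pI'/Pm.
by rewrite leqNgt; apply/negP => mk; apply/nP/pI'/pk.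
Qed.

(** A term that is not projective is nonzero, and it is a direct summand of the
    term of the same degree in any other injective coresolution. *)
Lemma profile_injdim X P Z m :
  has_profile X P Z -> (forall k, (m < k)%N -> Z k) -> ~ P m -> is_injdim X m.
Proof.
move=> [I [eps [d [mI pI zI]]]] Zm nP.
have cI : inj_cores eps d by case: mI.
split; first by exists I, eps, d; split=> // k /Zm/zI.
move=> k [I' [eps' [d' [cI' zI']]]]; rewrite leqNgt; apply/negP => km.
apply/nP/pI/(min_cores_projective mI cI')/zero_projective.
exact: zI'.
Qed.

End Coresolutions.

(** * Algebras over an oriented cycle *)

(** [e v] is the idempotent at the vertex [v] and [t] the sum of all arrows
    [v -> s v]. The axioms are preserved by passing to the opposite algebra
    and inverting [s]. *)
Record cyclic_pres (K : fieldType) (B : falgType K) (V : finType)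
    (s : V -> V) (e : V -> B) (t : B) : Prop := CyclicPres {
  cp_inj : injective s;
  cp_orth : forall u v, e u * e v = if u == v then e u else 0;
  cp_one : \sum_v e v = 1;
  cp_move : forall v, e v * t = t * e (s v);
  cp_nil : exists m, t ^+ m = 0;
  cp_gen : forall U : {vspace B}, (forall v l, e v * t ^+ l \in U) -> U = fullv;
  cp_nz : forall v, e v != 0 }.

Lemma linear_hom (K : fieldType) (X Y : vectType K) (f : X -> Y) :
  linear f -> exists F : 'Hom(X, Y), F =1 f.
Proof.
move=> lf; pose L := GRing.isLinear.Build K X Y _ f lf.
pose F : {linear X -> Y} := HB.pack f L.
by exists (linfun F) => x; rewrite lfunE.
Qed.

Section Presentation.
Variables (K : fieldType) (B : falgType K) (V : finType).
Variables (s : V -> V) (e : V -> B) (t : B).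
Hypothesis pres : cyclic_pres s e t.
Implicit Types (M N P E X Y Z : rmod B) (a b v : V).

Let e_orth := cp_orth pres.
Let s_inj := cp_inj pres.

Lemma iter_inj l : injective (iter l s).
Proof. by elim: l => //= l IHl x y /s_inj/IHl. Qed.

Lemma move_exp v l : e v * t ^+ l = t ^+ l * e (iter l s v).
Proof.
elim: l v => [|l IHl] v; first by rewrite !expr0 mulr1 mul1r.
by rewrite exprS mulrA (cp_move pres) -mulrA IHl mulrA iterSr.
Qed.

Lemma e_exp_e v l w :
  e v * t ^+ l * e w = if iter l s v == w then e v * t ^+ l else 0.
Proof.
rewrite move_exp -mulrA e_orth; case: eqP => // _; by rewrite mulr0.
Qed.

Lemma nil_bound : exists m, forall k, (m <= k)%N -> t ^+ k = 0.
Proof.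
have [m tm] := cp_nil pres; exists m => k mk.
by rewrite -(subnKC mk) exprD tm mul0r.
Qed.

Lemma sum_act_e M (y : M) : y = \sum_v y ** e v.
Proof.
rewrite -[LHS]ract1 -(cp_one pres) -actrE linear_sum.
by apply: eq_bigr => v _; apply: actrE.
Qed.

Lemma submoduleP M (U : {vspace M}) :
  (forall y v, y \in U -> y ** e v \in U) -> (forall y, y \in U -> y ** t \in U) ->
  submodule U.
Proof.
move=> Ue Ut y a yU; rewrite -actrE memv_preim.
suff -> : (actr y @^-1: U)%VS = fullv by rewrite memvf.
apply: (cp_gen pres) => v l; rewrite -memv_preim actrE ractM.
by elim: l => [|l IHl]; rewrite ?expr0 ?ract1 ?Ue // exprSr ractM Ut.
Qed.

Lemma is_homP M N (f : 'Hom(M, N)) :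
  (forall y v, f (y ** e v) = f y ** e v) -> (forall y, f (y ** t) = f y ** t) ->
  is_hom f.
Proof.
move=> fe ft y a.
have : a \in lker ((f \o actr y) - actr (f y))%VF.
  suff -> : lker ((f \o actr y) - actr (f y))%VF = fullv by rewrite memvf.
  apply: (cp_gen pres) => v l; apply/eqlfunP; rewrite comp_lfunE !actrE !ractM.
  rewrite -fe; elim: l (y ** e v) => [|l IHl] z; first by rewrite !expr0 !ract1.
  by rewrite !exprS !ractM IHl ft.
by move/eqlfunP; rewrite comp_lfunE !actrE.
Qed.

Lemma act_top M (y : M) a l v : y ** e a = y ->
  y ** t ^+ l ** e v = if iter l s a == v then y ** t ^+ l else 0.
Proof.
move=> ya; rewrite -[in LHS]ya -!ractM mulrA e_exp_e.
by case: ifP => _; rewrite ?ractM ?ya // actr0.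
Qed.

(** The elements [G i ** t ^+ k] span, because their span is stable under [t]
    and the idempotents. *)
Lemma gens_ind (I : finType) X (G : I -> X) (top : I -> V) :
  (forall i, G i ** e (top i) = G i) ->
  (forall U : {vspace X}, submodule U -> (forall i, G i \in U) -> U = fullv) ->
  forall U : {vspace X}, (forall i k, G i ** t ^+ k \in U) -> U = fullv.
Proof.
move=> Gtop Ggen U Uk; have [m tm] := nil_bound.
pose S := span [seq G i ** t ^+ k | i <- enum I, k <- iota 0 m].
have Sk i k : G i ** t ^+ k \in S.
  have [km|mk] := ltnP k m; last by rewrite tm // actr0 mem0v.
  by apply/memv_span/allpairsP; exists (i, k); rewrite mem_enum mem_iota.
have Sful : S = fullv.
  apply: Ggen => [|i]; last by have := Sk i 0; rewrite expr0 ract1.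
  suff Sgen (f : 'End(X)) : (forall i k, f (G i ** t ^+ k) \in S) ->
      forall y, y \in S -> f y \in S.
    apply: submoduleP => [y v|y].
      rewrite -!ract_lfunE; apply: Sgen => i k; rewrite ract_lfunE (act_top _ _ (Gtop i)).
      by case: ifP => // _; rewrite mem0v.
    rewrite -!ract_lfunE; apply: Sgen => i k; rewrite ract_lfunE -ractM -exprSr.
    exact: Sk.
  move=> fS y yS; rewrite memv_preim; move: y yS; apply/subvP/span_subvP.
  by move=> _ /allpairsP[[i k] /= [_ _ ->]]; rewrite -memv_preim.
apply/eqP; rewrite eqEsubv subvf -Sful; apply/span_subvP => _ /allpairsP[[i k] /= [_ _ ->]].
exact: Uk.
Qed.

(** ** Uniserial modules generated at a vertex *)

(** [X] has the basis [u, u ** t, ..., u ** t ^+ m.-1] along the path of length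
    [m.-1] that starts at [a]; the last element spans the socle. For [m = 0] the
    second and third conditions are contradictory. *)
Definition chain X a m (u : X) : Prop :=
  [/\ u ** e a = u, u ** t ^+ m = 0, u ** t ^+ m.-1 != 0 &
      forall U : {vspace X}, submodule U -> u \in U -> U = fullv].

Lemma chain_gt0 X a m (u : X) : chain a m u -> (0 < m)%N.
Proof. by case: m => // -[_ /= u0]; rewrite u0 eqxx. Qed.

Lemma chain_ge X a m (u : X) k : chain a m u -> (m <= k)%N -> u ** t ^+ k = 0.
Proof. by move=> [_ u0 _ _] mk; rewrite -(subnKC mk) exprD ractM u0 act0l. Qed.

Lemma chain_nz X a m (u : X) k : chain a m u -> (k < m)%N -> u ** t ^+ k != 0.
Proof.
move=> [_ _ + _] km; apply: contra => /eqP uk; have km' : (k <= m.-1)%N by case: m km.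
by rewrite -(subnKC km') exprD ractM uk act0l.
Qed.

Lemma chain_ind X a m (u : X) : chain a m u ->
  forall U : {vspace X}, (forall k, u ** t ^+ k \in U) -> U = fullv.
Proof.
move=> [ua _ _ ugen] U Uk.
by apply: (@gens_ind unit X (fun=> u) (fun=> a)) => // W sW uW; apply: ugen (uW tt).
Qed.

Lemma chain_mem X a m (u : X) (U : {vspace X}) y : chain a m u ->
  (forall k, u ** t ^+ k \in U) -> y \in U.
Proof. by move=> cX Uk; rewrite (chain_ind cX Uk) memvf. Qed.

(** Multiplying a linear relation between the [u ** t ^+ k] by a power of [t]
    isolates its first coefficient in the socle. *)
Lemma chain_coords X a m (u : X) : chain a m u ->
  exists c : nat -> 'Hom(X, K^o),
    (forall y, y = \sum_(k < m) c k y *: (u ** t ^+ k)) /\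
    (forall i j, (i < m)%N -> c i (u ** t ^+ j) = (i == j)%:R).
Proof.
move=> cX; pose b := [tuple u ** t ^+ i | i < m].
have bE i : (i < m)%N -> b`_i = u ** t ^+ i.
  by move=> im; rewrite -(tnth_nth _ _ (Ordinal im)) tnth_mktuple.
have fb : free b.
  apply/freeP => k k0 [i im]; elim/ltn_ind: i im => i IHi im.
  have /(congr1 (fun y => y ** t ^+ (m.-1 - i))) := k0.
  rewrite /= act0l act_suml (bigD1 (Ordinal im)) //= [X in _ + X]big1 => [|j ji].
    have imm : (i <= m.-1)%N by case: m im {b bE cX k k0 IHi}.
    rewrite addr0 actZl bE // -ractM -exprD subnKC // => /eqP.
    rewrite scaler_eq0 => /orP[/eqP//|]; have [_ _ /negPf-> _] := cX.
    by [].
  have [ltji|] := ltnP j i.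
    by case: j ltji {ji} => j jm /= ji; rewrite IHi // scale0r act0l.
  rewrite leq_eqVlt eq_sym (negPf (ji : (j : nat) != i)) /= => ij.
  by rewrite actZl bE // -ractM -exprD (chain_ge cX) ?scaler0 //; lia.
have bfull : <<b>>%VS = fullv.
  apply: (chain_ind cX) => k; have [km|mk] := ltnP k m.
    apply: memv_span; rewrite -(bE _ km); apply: mem_nth.
    by rewrite size_tuple.
  by rewrite (chain_ge cX mk) mem0v.
have coordX (i : 'I_m) : exists F : 'Hom(X, K^o), F =1 coord b i.
  by apply: linear_hom => k y z; rewrite linearP.
have /fin_all_exists[F FE] : forall i : 'I_m, exists F : 'Hom(X, K^o), F =1 coord b i.
  by [].
exists (fun k => if insub k is Some i then F i else 0).
have FE' (i : 'I_m) y : (if insub (i : nat) is Some i then F i else 0) y = coord b i y.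
  by rewrite valK FE.
split=> [y|i j im].
  have yb : y \in <<b>>%VS by rewrite bfull memvf.
  rewrite {1}(coord_span yb); apply: eq_bigr => i _.
  by rewrite FE' bE.
rewrite (FE' (Ordinal im)); have [jm|mj] := ltnP j m.
  by rewrite -(bE _ jm) eq_sym; apply: (coord_free (Ordinal jm) (Ordinal im) fb).
rewrite (chain_ge cX mj) linear0; case: eqP => // ij.
by move: im; rewrite ij ltnNge mj.
Qed.

End Presentation.

Section Chains.
Variables (K : fieldType) (B : falgType K) (V : finType).
Variables (s : V -> V) (e : V -> B) (t : B).
Hypothesis pres : cyclic_pres s e t.
Implicit Types (M N P E X Y Z : rmod B) (a b v : V).
Local Notation chain := (chain e t).

Lemma chain_univ X a m (u : X) Z (z : Z) : chain a m u ->
  z ** e a = z -> z ** t ^+ m = 0 -> exists f : 'Hom(X, Z), is_hom f /\ f u = z.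
Proof.
move=> cX za zm; have [c [cE cu]] := chain_coords pres cX.
have [ua _ _ _] := cX.
have [y|f fE] := @linear_hom K X Z (fun y => \sum_(k < m) c k y *: (z ** t ^+ k)).
  move=> y1 y2; rewrite scaler_sumr -big_split /=; apply: eq_bigr => k _.
  by rewrite linearP scalerDl scalerA.
have fu k : f (u ** t ^+ k) = z ** t ^+ k.
  rewrite fE; have [km|mk] := ltnP k m; last first.
    rewrite (chain_ge cX mk) -(subnKC mk) exprD ractM zm act0l big1 // => i _.
    by rewrite linear0 scale0r.
  rewrite (bigD1 (Ordinal km)) //= cu // eqxx scale1r big1 ?addr0 // => i ik.
  by rewrite cu // (negPf (ik : (i : nat) != k)) scale0r.
exists f; split; last by have := fu 0%N; rewrite expr0 !ract1.
apply: (is_homP pres) => [y v|y].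
  suff : y \in lker ((f \o ract_lfun X (e v)) - (ract_lfun Z (e v) \o f))%VF.
    by move/eqlfunP; rewrite !comp_lfunE !ract_lfunE.
  apply: (chain_mem pres _ cX) => k; apply/eqlfunP.
  rewrite !comp_lfunE !ract_lfunE fu (act_top pres _ _ ua) (act_top pres _ _ za).
  by case: ifP => _; rewrite ?fu ?linear0.
suff : y \in lker ((f \o ract_lfun X t) - (ract_lfun Z t \o f))%VF.
  by move/eqlfunP; rewrite !comp_lfunE !ract_lfunE.
apply: (chain_mem pres _ cX) => k; apply/eqlfunP.
by rewrite !comp_lfunE !ract_lfunE fu -!ractM -exprSr fu.
Qed.

Lemma hom_eq_gen X Z (u : X) (f g : 'Hom(X, Z)) :
  (forall U : {vspace X}, submodule U -> u \in U -> U = fullv) ->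
  is_hom f -> is_hom g -> f u = g u -> f = g.
Proof.
move=> ugen hf hg fg; apply/lfunP => y; apply/eqlfunP.
suff -> : lker (f - g) = fullv by apply: memvf.
apply: ugen; last exact/eqlfunP.
by move=> z a /eqlfunP E; apply/eqlfunP; rewrite hf hg E.
Qed.

Lemma chain_act_ge X a m (u y : X) : chain a m u -> y ** t ^+ m = 0.
Proof.
move=> cX; have [_ um _ _] := cX.
suff : y \in lker (ract_lfun X (t ^+ m)) by rewrite memv_ker ract_lfunE => /eqP.
apply: (chain_mem pres _ cX) => k.
by rewrite memv_ker ract_lfunE -ractM -exprD addnC exprD ractM um act0l.
Qed.

(** From the socle upwards: a power of [t] brings the lowest term of [y] to any
    later place [u ** t ^+ l], and the other terms to still later places, where
    they are known to lie in [U]. *)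
Lemma chain_lead X a m (u : X) (U : {vspace X}) y j (c : nat -> K) :
  chain a m u -> submodule U -> y \in U ->
  y = \sum_(k < m) c k *: (u ** t ^+ k) ->
  (forall i, (i < j)%N -> c i = 0) -> (j < m)%N -> c j != 0 -> u ** t ^+ j \in U.
Proof.
move=> cX sU yU yE c0 jm cj.
suff down d : (d <= m - j)%N -> u ** t ^+ (m - d) \in U.
  by have := down (m - j)%N (leqnn _); rewrite subKn // ltnW.
elim/ltn_ind: d => d IHd dmj.
have [->|d0] := posnP d; first by rewrite subn0 (chain_ge cX) ?mem0v.
have /(congr1 (fun z => z ** t ^+ (m - d - j))) := yE.
rewrite /= act_suml (bigD1 (Ordinal jm)) //= actZl -ractM -exprD.
have -> : (j + (m - d - j) = m - d)%N by lia.
move=> E; have : c j *: (u ** t ^+ (m - d)) \in U.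
  rewrite -[X in X \in _](addrK (\sum_(i < m | i != Ordinal jm)
    c i *: (u ** t ^+ i) ** t ^+ (m - d - j))) -E memvB //; first exact: sU.
  apply: memv_suml => i ij; have [ltij|leji] := ltnP i j.
    by rewrite c0 // scale0r act0l mem0v.
  rewrite actZl memvZ // -ractM -exprD.
  have {ij} ij : (i : nat) != j by [].
  have im := ltn_ord i.
  have [|le] := ltnP (i + (m - d - j)) m; last by rewrite (chain_ge cX le) mem0v.
  move=> lt; have -> : (i + (m - d - j) = m - (m - (i + (m - d - j))))%N by lia.
  by apply: IHd; lia.
by move/(memvZ (c j)^-1); rewrite scalerA mulVf // scale1r.
Qed.

(** A submodule contains, with an element [y], every path [u ** t ^+ j] that
    occurs in [y]: the lowest one by [chain_lead], and so all later ones.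
    Everything about the submodules of a chain follows from this. *)
Lemma chain_mono X a m (u : X) (U : {vspace X}) (c : nat -> 'Hom(X, K^o)) y j :
  chain a m u -> (forall y, y = \sum_(k < m) c k y *: (u ** t ^+ k)) ->
  submodule U -> y \in U -> (j < m)%N -> c j y != 0 -> u ** t ^+ j \in U.
Proof.
move=> cX cE sU yU jm cj.
have ex : exists i, c i y != 0 by exists j.
case: (ex_minnP ex) => i ci imin; have ij := imin _ cj.
have uiU : u ** t ^+ i \in U.
  have c0 k : (k < i)%N -> c k y = 0.
    by move=> ki; apply/eqP; apply: contraTT ki => /imin; rewrite -leqNgt.
  exact: (chain_lead cX sU yU (cE y) c0 (leq_ltn_trans ij jm) ci).
by rewrite -(subnKC ij) exprD ractM sU.
Qed.

Lemma chain_sub X a m (u : X) (U U' : {vspace X}) :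
  chain a m u -> submodule U ->
  (forall j, (j < m)%N -> u ** t ^+ j \in U -> u ** t ^+ j \in U') -> (U <= U')%VS.
Proof.
move=> cX sU UU'; apply/subvP => y yU.
have [c [cE _]] := chain_coords pres cX; rewrite [y]cE memv_suml // => j _.
have [->|cj] := eqVneq (c j y) 0; first by rewrite scale0r mem0v.
by rewrite memvZ // UU' // (chain_mono cX cE sU yU).
Qed.

Lemma chain_uniserial X a m (u : X) : chain a m u -> uniserial X.
Proof.
move=> cX U W sU sW.
have [UW|/subvPn[y yU yW]] := boolP (U <= W)%VS; first by left.
right; apply: (chain_sub cX sW) => i im uiW.
have [c [cE _]] := chain_coords pres cX.
have [j jm [ujU ujW]] : exists2 j, (j < m)%N & u ** t ^+ j \in U /\ u ** t ^+ j \notin W.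
  have [/existsP[j /andP[? ?]]|/existsPn no] :=
      boolP [exists j : 'I_m, (u ** t ^+ j \in U) && (u ** t ^+ j \notin W)].
    by exists j.
  case/negP: yW; rewrite [y]cE memv_suml // => j _.
  have [->|cj] := eqVneq (c j y) 0; first by rewrite scale0r mem0v.
  have := no j; rewrite (chain_mono cX cE sU yU) //= negbK.
  exact: memvZ.
have ji : (j <= i)%N.
  rewrite leqNgt; apply: contra ujW => ij.
  by rewrite -(subnKC (ltnW ij)) exprD ractM sW.
by rewrite -(subnKC ji) exprD ractM sU.
Qed.

Lemma chain_full_nz X a m (u : X) : chain a m u -> {:X}%VS <> 0%VS.
Proof.
move=> cX X0; have [_ _ /eqP nz _] := cX; apply: nz.
exact: mem_zero X0 (memvf _).
Qed.

Lemma uniserial_indecomposable X : {:X}%VS <> 0%VS -> uniserial X -> indecomposable X.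
Proof.
move=> X0 uX; split=> // U W sU sW _ UW.
by case: (uX U W sU sW) => [/capv_idPl|/capv_idPr] E; [left | right]; rewrite -E.
Qed.

Lemma chain_indecomposable X a m (u : X) : chain a m u -> indecomposable X.
Proof.
by move=> cX; apply: uniserial_indecomposable; [apply: chain_full_nz cX | apply: chain_uniserial cX].
Qed.

Lemma chain_socle X a m (u : X) (U : {vspace X}) :
  chain a m u -> submodule U -> U <> 0%VS -> u ** t ^+ m.-1 \in U.
Proof.
move=> cX sU U0; have [//|no] := boolP (u ** t ^+ m.-1 \in U); case: U0.
apply/eqP; rewrite -subv0; apply: (chain_sub cX sU) => j jm ujU.
have jm' : (j <= m.-1)%N by lia.
by case/negP: no; rewrite -(subnKC jm') exprD ractM sU.
Qed.

Lemma chain_essential X a m (u : X) (U : {vspace X}) :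
  chain a m u -> submodule U -> U <> 0%VS -> essential U.
Proof.
move=> cX sU U0 W sW W0 UW; have [_ _ /eqP nz _] := cX; apply: nz.
apply: mem_zero UW _; rewrite memv_cap.
by rewrite (chain_socle cX sU U0) (chain_socle cX sW W0).
Qed.

Lemma chain_ker0 X a m (u : X) Z (f : 'Hom(X, Z)) :
  chain a m u -> is_hom f -> f u ** t ^+ m.-1 != 0 -> lker f = 0%VS.
Proof.
move=> cX hf nz; apply/eqP; apply: contraTT nz => /eqP k0.
have := chain_socle cX (lker_submodule hf) k0.
by rewrite negbK memv_ker hf.
Qed.

Lemma chain_onto X Z a m (z : Z) (f : 'Hom(X, Z)) (u : X) :
  chain a m z -> is_hom f -> f u = z -> limg f = fullv.
Proof.
move=> [_ _ _ zgen] hf fu; apply: zgen; first exact: limg_submodule.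
by rewrite -fu memv_img ?memvf.
Qed.

(** The coefficient [c] of the generator is a functional that sees the top of
    a chain: it is killed by [t] and by the idempotents at other vertices. *)
Lemma chain_top X a m (u : X) : chain a m u ->
  exists c : 'Hom(X, K^o),
  [/\ c u = 1, forall y v, c (y ** e v) = if a == v then c y else 0,
      forall y, c (y ** t) = 0 &
      forall (U : {vspace X}) y, submodule U -> y \in U -> c y != 0 -> U = fullv].
Proof.
move=> cX; have [c [cE cu]] := chain_coords pres cX; have [ua _ _ ugen] := cX.
have m0 := chain_gt0 cX; exists (c 0%N); split.
- by have := cu 0%N 0%N m0; rewrite expr0 ract1.
- move=> y v; suff : y \in lker ((c 0%N \o ract_lfun X (e v))%VF
    - (if a == v then c 0%N else 0)).
    by move/eqlfunP; rewrite comp_lfunE ract_lfunE; case: ifP => //; rewrite zero_lfunE.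
  apply: (chain_mem pres _ cX) => k; apply/eqlfunP.
  rewrite comp_lfunE ract_lfunE (act_top pres _ _ ua).
  case: k => [|k] /=; first by case: ifP; rewrite ?linear0 ?zero_lfunE.
  have ck : c 0%N (u ** t ^+ k.+1) = 0 by rewrite cu.
  by case: ifP; case: ifP; rewrite ?linear0 ?zero_lfunE ?ck.
- move=> y; suff : y \in lker (c 0%N \o ract_lfun X t)%VF.
    by rewrite memv_ker comp_lfunE ract_lfunE => /eqP.
  apply: (chain_mem pres _ cX) => k.
  by rewrite memv_ker comp_lfunE ract_lfunE -ractM -exprSr cu.
- move=> U y sU yU cy; apply: ugen => //.
  by have := chain_mono cX cE sU yU m0 cy; rewrite expr0 ract1.
Qed.

(** Elements of [Y] over the generator of a quotient [X] generate [Y], for the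
    top functionals of [X] and [Y] agree. *)
Lemma chain_lift_gen X Y a m m' (x : X) (y : Y) (g : 'Hom(Y, X)) z (U : {vspace Y}) :
  chain a m x -> chain a m' y -> is_hom g -> g y = x ->
  g z = x -> submodule U -> z \in U -> U = fullv.
Proof.
move=> cX cY hg gy gz sU zU.
have [c [c1 _ ct _]] := chain_top cX; have [c' [c'1 _ c't c'full]] := chain_top cY.
apply: (c'full _ z) => //; suff <- : c (g z) = c' z by rewrite gz c1 oner_eq0.
suff : z \in lker ((c \o g)%VF - c') by move/eqlfunP; rewrite comp_lfunE.
apply: (chain_mem pres _ cY) => -[|k]; apply/eqlfunP.
  by rewrite expr0 ract1 comp_lfunE gy c1 c'1.
by rewrite exprSr ractM comp_lfunE hg ct c't.
Qed.

(** ** Projectivity and injectivity *)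

Lemma chain_projective X a m (u : X) :
  chain a m u -> e a * t ^+ m = 0 -> projective X.
Proof.
move=> cX ea0 M N g f hg gfull hf; have [ua um _ ugen] := cX.
have /mem_limg[z zE] : f u \in limg g by rewrite gfull memvf.
have e2 : e a * e a = e a by rewrite (cp_orth pres) eqxx.
have [||h [hh hu]] := @chain_univ X a m u M (z ** e a) cX.
- by rewrite -ractM e2.
- by rewrite -ractM ea0 actr0.
exists h; split=> //; apply: (hom_eq_gen ugen) => //; first exact: is_hom_comp.
by rewrite comp_lfunE hu hg -zE -hf ua.
Qed.

(** A section of the map from the longer chain would be onto, and [t ^+ m] kills
    the shorter chain only. *)
Lemma chain_not_projective X Y a m m' (x : X) (y : Y) :
  chain a m x -> chain a m' y -> (m < m')%N -> ~ projective X.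
Proof.
move=> cX cY mm' pX; have [xa xm _ xgen] := cX; have [ya ym' _ _] := cY.
have [|g [hg gy]] := chain_univ cY xa.
  exact: chain_ge cX (ltnW mm').
have gfull := chain_onto cX hg gy.
have [h [hh hE]] := pX _ _ g \1%VF hg gfull (@is_hom_id _ _ _).
have hfull : limg h = fullv.
  apply: (chain_lift_gen cX cY hg gy (z := h x)); last by rewrite memv_img ?memvf.
    by rewrite -comp_lfunE hE id_lfunE.
  exact: limg_submodule.
have /mem_limg[z yz] : y \in limg h by rewrite hfull memvf.
have := chain_nz cY mm'; rewrite yz -hh (chain_act_ge _ cX) linear0.
by rewrite eqxx.
Qed.

(** Injectivity by duality: homomorphisms from [N] to the chain correspond to
    linear functionals on [N ** e b], for [b] the vertex of the socle, and
    functionals extend along monomorphisms. The functional [mu] gives back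
    the homomorphism with coefficients [mu (y ** q k)]; the hypothesis says
    that no path of length [m.+1] ends at [b], and makes it compatible with [t]. *)
Lemma chain_injective X a m (u : X) :
  chain a m.+1 u -> t ^+ m.+1 * e (iter m s a) = 0 -> injective_mod X.
Proof.
move=> cX teb M N g f hg kg hf.
have [c [cE cu]] := chain_coords pres cX; have [ua um _ _] := cX.
set b := iter m s a in teb.
pose q k := t ^+ (m - k) * e b; pose lam := c m.
have qe v k : (k < m.+1)%N -> e v * q k = if iter k s a == v then q k else 0.
  move=> km; rewrite /q mulrA (move_exp pres) -mulrA (cp_orth pres) /b.
  have -> : iter m s a = iter (m - k) s (iter k s a).
    by rewrite -iterD; congr (iter _ _ _); lia.
  rewrite (inj_eq (iter_inj pres (l := m - k))) eq_sym.
  by case: eqP => [<-|_]; rewrite ?mulr0.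
have expand y : y = \sum_(k < m.+1) lam (y ** q k) *: (u ** t ^+ k).
  have [F FE] : exists F : 'End(X), F =1 fun y => \sum_(k < m.+1) lam (y ** q k) *: (u ** t ^+ k).
    apply: linear_hom => r y1 y2; rewrite scaler_sumr -big_split /=.
    by apply: eq_bigr => k _; rewrite ract_linearl linearP scalerDl scalerA.
  suff : y \in lker (F - \1)%VF by move/eqlfunP; rewrite FE id_lfunE.
  apply: (chain_mem pres _ cX) => j; apply/eqlfunP; rewrite FE id_lfunE.
  have [jm|mj] := ltnP j m.+1; last first.
    by rewrite (chain_ge cX mj) big1 // => k _; rewrite act0l linear0 scale0r.
  have lamE k : (k < m.+1)%N -> lam (u ** t ^+ j ** q k) = (k == j)%:R.
    move=> km; rewrite /q ractM -(ractM u) -exprD (act_top pres _ _ ua).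
    have [lt|ge] := ltnP (j + (m - k)) m.+1; last first.
      rewrite (chain_ge cX ge); case: ifP => _; rewrite linear0; case: eqP => //; lia.
    have [->|kj] := eqVneq k j.
      have -> : (j + (m - j) = m)%N by lia.
      by rewrite eqxx /lam cu ?eqxx //; lia.
    case: ifP => _; last by rewrite linear0.
    by rewrite /lam cu; [rewrite (_ : (_ == _) = false) //; apply/eqP; lia | lia].
  rewrite (bigD1 (Ordinal jm)) //= lamE // eqxx scale1r big1 ?addr0 // => k kj.
  by rewrite lamE // (negPf (kj : (k : nat) != j)) scale0r.
pose mu : 'Hom(N, K^o) := ((lam \o f) \o g^-1)%VF.
have [h hE] : exists h : 'Hom(N, X), h =1 fun y => \sum_(k < m.+1) mu (y ** q k) *: (u ** t ^+ k).
  apply: linear_hom => r y1 y2; rewrite scaler_sumr -big_split /=.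
  by apply: eq_bigr => k _; rewrite ract_linearl linearP scalerDl scalerA.
exists h; split; last first.
  apply/lfunP => z; rewrite comp_lfunE hE [in RHS](expand (f z)).
  apply: eq_bigr => k _; rewrite /mu !comp_lfunE -hg lker0_lfunK ?hf //.
  exact/eqP.
apply: (is_homP pres) => [y v|y]; rewrite !hE act_suml.
  apply: eq_bigr => k _; rewrite actZl (act_top pres _ _ ua) -ractM qe //.
  by case: ifP => _ //; rewrite actr0 linear0 scale0r scaler0.
(* After the shift of the index, only the extreme terms are left over; they
   vanish by [teb] and [um]. *)
rewrite big_ord_recl big_ord_recr /= actZl -(ractM u) -exprSr um scaler0 addr0.
rewrite -ractM /q subn0 mulrA -exprS teb actr0 linear0 scale0r add0r.
apply: eq_bigr => k _; rewrite actZl -!ractM -exprSr mulrA -exprS.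
by rewrite /bump /= add1n -subSn // subSS.
Qed.

End Chains.

Section ChainConstructions.
Variables (K : fieldType) (B : falgType K) (V : finType).
Variables (s : V -> V) (e : V -> B) (t : B).
Hypothesis pres : cyclic_pres s e t.
Implicit Types (M N P E X Y Z : rmod B) (a b v : V).
Local Notation chain := (chain e t).

(** The chain of length [l + m] is an extension of its quotient of length [l] by
    its submodule of length [m], whose top lies [l] arrows further. *)
Lemma chain_extension X E Y a l m (x : X) (u : E) (y : Y) :
  chain a (l + m) u -> chain (iter l s a) m x -> chain a l y ->
  exists (f : 'Hom(X, E)) (g : 'Hom(E, Y)),
    [/\ is_hom f /\ is_hom g, lker f = 0%VS, limg f = lker g & limg g = fullv].
Proof.
move=> cE cX cY; have [ua ulm _ _] := cE; have [ya yl _ _] := cY.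
have m0 := chain_gt0 cX.
have [||f [hf fx]] := @chain_univ _ _ _ _ _ _ pres _ _ _ x E (u ** t ^+ l) cX.
- by rewrite (act_top pres _ _ ua) eqxx.
- by rewrite -ractM -exprD.
have [||g [hg gu]] := @chain_univ _ _ _ _ _ _ pres _ _ _ u Y y cE => //.
  by rewrite exprD ractM yl act0l.
exists f, g; split=> //.
- apply: (chain_ker0 pres cX hf); rewrite fx -ractM -exprD (chain_nz cE) //; lia.
- apply/eqP; rewrite eqEsubv; apply/andP; split.
    apply/subvP => _ /mem_limg[z ->]; rewrite memv_preim.
    apply: (chain_mem pres _ cX) => k; rewrite -memv_preim memv_ker hf fx !hg gu.
    by rewrite yl act0l.
  apply: (chain_sub pres cE (lker_submodule hg)) => j _.
  rewrite memv_ker hg gu => yj; have [jl|lj] := ltnP j l.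
    by have := chain_nz cY jl; rewrite yj.
  apply/mem_limg; exists (x ** t ^+ (j - l)).
  by rewrite hf fx -ractM -exprD subnKC.
- exact: chain_onto cY hg gu.
Qed.

Lemma chain_quot X a m l (u : X) (U : {vspace X}) (sU : submodule U) :
  chain a m u -> u ** t ^+ l \in U -> u ** t ^+ l.-1 \notin U ->
  chain a l (quot_proj sU u).
Proof.
move=> cX uU unU; have [ua _ _ ugen] := cX; have hq := quot_proj_hom sU.
have qE k : quot_proj sU u ** t ^+ k = quot_proj sU (u ** t ^+ k) by rewrite hq.
split.
- by rewrite -hq ua.
- by apply/eqP; rewrite qE -memv_ker quot_proj_ker.
- by rewrite qE -memv_ker quot_proj_ker.
move=> W sW quW; have /eqP := quot_proj_full sU; rewrite eqEsubv => /andP[_ qfull].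
apply/eqP; rewrite eqEsubv subvf (subv_trans qfull) //.
apply/subvP => _ /memv_imgP[z _ ->]; rewrite memv_preim.
have -> : (quot_proj sU @^-1: W)%VS = fullv.
  by apply: ugen; rewrite -?memv_preim // => w c; rewrite -!memv_preim hq; apply: sW.
exact: memvf.
Qed.

(** The quotient by the submodule [X ** t ^+ l]. *)
Lemma chain_truncate X a m l (u : X) : chain a m u -> (0 < l <= m)%N ->
  exists (Y : rmod B) (y : Y), chain a l y.
Proof.
move=> cX /andP[l0 lm]; pose U := limg (ract_lfun X (t ^+ l)).
have sU : submodule U.
  apply: (submoduleP pres) => [_ v|_] /mem_limg[y ->]; apply/mem_limg.
    exists (y ** e (invF (iter_inj pres (l := l)) v)); rewrite !ract_lfunE -!ractM.
    by rewrite (move_exp pres) f_invF.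
  by exists (y ** t); rewrite !ract_lfunE -!ractM -exprS -exprSr.
exists (quotmod sU), (quot_proj sU u); apply: (chain_quot sU cX).
  by apply/mem_limg; exists u; rewrite ract_lfunE.
apply/negP => /mem_limg[y]; rewrite ract_lfunE => uy.
have [_ _ /eqP nz _] := cX; apply: nz.
have -> : (m.-1 = l.-1 + (m - l))%N by lia.
by rewrite exprD ractM uy -ractM -exprD subnKC // (chain_act_ge pres _ cX).
Qed.

(** ** The projective modules at the vertices *)

Lemma memv_rideal (c f : B) : c * c = c ->
  reflect (f = c * f) (f \in (<[c]> * fullv)%VS).
Proof.
move=> c2; apply: (iffP idP) => [|->]; last by rewrite memv_mul ?memv_line ?memvf.
have lin : linear (fun g => c * g - g).
  by move=> k g h; rewrite mulrDr -scalerAr scalerBr addrACA opprD.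
have [F FE] := linear_hom lin.
have : (<[c]> * fullv <= lker F)%VS.
  apply/prodvP => _ b /vlineP[k ->] _; rewrite memv_ker FE -!scalerAl -scalerAr.
  by rewrite mulrA c2 subrr.
by move=> /subvP h /h; rewrite memv_ker FE subr_eq0 => /eqP.
Qed.

Fact emod_gen_mem (c : B) : c \in (<[c]> * fullv)%VS.
Proof. by rewrite -{1}[c]mulr1 memv_mul ?memv_line ?memvf. Qed.

Definition emod_gen (c : B) : emod c := Subvs (emod_gen_mem c).

Lemma emod_chain a m :
  e a * t ^+ m = 0 -> e a * t ^+ m.-1 != 0 -> chain a m (emod_gen (e a)).
Proof.
move=> em enz; have e2 : e a * e a = e a by rewrite (cp_orth pres) eqxx.
split.
- exact: val_inj.
- exact: val_inj.
- by apply: contra enz => /eqP/(congr1 val)/= ->.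
move=> U sU eU; apply: full_mem => y.
have /(memv_rideal _ e2) yE := valP y.
suff -> : y = emod_gen (e a) ** val y by apply: sU.
exact: val_inj.
Qed.

Lemma emod_chain_ex a : exists m, e a * t ^+ m = 0 /\ chain a m (emod_gen (e a)).
Proof.
have ex : exists m, e a * t ^+ m == 0.
  by have [m tm] := cp_nil pres; exists m; rewrite tm mulr0.
case: (ex_minnP ex) => m /eqP em mmin; exists m; split=> //.
apply: emod_chain => //; case: m em mmin => [|m] em mmin /=.
  by move: em; rewrite expr0 mulr1 => /eqP; rewrite (negPf (cp_nz pres a)).
by apply/negP => /mmin; rewrite ltnn.
Qed.

(** ** Representation theory of algebras over an oriented cycle *)

(** The kernel of [t] is a nonzero submodule, since [t] is nilpotent. Hence [t]
    kills a simple module, which is therefore a line at a single vertex. *)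
Lemma pres_split : split_alg B.
Proof.
move=> S f [S0 Ssimple] hf.
have kt : lker (ract_lfun S t) = fullv.
  have sk : submodule (lker (ract_lfun S t)).
    apply: (submoduleP pres) => [y v|y]; rewrite memv_ker ract_lfunE => /eqP y0.
      rewrite memv_ker ract_lfunE -ractM (cp_move pres).
      by rewrite ractM y0 act0l.
    by rewrite memv_ker ract_lfunE y0 act0l.
  have [k0|//] := Ssimple _ sk; case: S0; apply: zero_mem => y _.
  have [m tm] := cp_nil pres; have := actr0 y; rewrite -tm.
  elim: m {tm} => [|m IHm]; first by rewrite expr0 ract1.
  rewrite exprSr ractM => y0; apply: IHm; apply: (mem_zero k0).
  by rewrite memv_ker ract_lfunE y0.
have t0 (y : S) : y ** t = 0.
  by apply/eqP; rewrite -ract_lfunE -memv_ker kt memvf.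
have [y [a [y0 ya]]] : exists (y : S) a, y != 0 /\ y ** e a = y.
  have [/existsP[a nz]|/existsPn no] := boolP [exists a, vpick {:S}%VS ** e a != 0].
    exists (vpick {:S}%VS ** e a), a; split=> //.
    by rewrite -ractM (cp_orth pres) eqxx.
  case: S0; apply/eqP; rewrite -vpick0 (sum_act_e pres (vpick _)) big1 // => a _.
  by apply/eqP; have := no a; rewrite negbK.
have line : <[y]>%VS = fullv.
  have sy : submodule <[y]>%VS.
    apply: (submoduleP pres) => [_ v|_] /vlineP[k ->]; rewrite actZl.
      rewrite memvZ //; have := act_top pres 0 v ya; rewrite expr0 ract1 => ->.
      by case: ifP; rewrite ?memv_line ?mem0v.
    by rewrite t0 scaler0 mem0v.
  have [y00|//] := Ssimple _ sy; case/eqP: y0; apply: mem_zero y00 _.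
  exact: memv_line.
have /vlineP[c fy] : f y \in <[y]>%VS by rewrite line memvf.
exists c; apply/lfunP => z; have /vlineP[k ->] : z \in <[y]>%VS by rewrite line memvf.
by rewrite linearZ /= fy scale_lfunE id_lfunE scalerA mulrC -scalerA.
Qed.

Lemma emod_indecomposable a : indecomposable (emod (e a)).
Proof. by have [m [_ /(chain_indecomposable pres)]] := emod_chain_ex a. Qed.

(** The top functional of [emod (e b)] does not vanish on the image of the
    generator of [emod (e a)], which lies at [a]. *)
Lemma emod_iso a b : isomorphic (emod (e a)) (emod (e b)) -> a = b.
Proof.
case=> f [hf kf ff]; have [m [_ cX]] := emod_chain_ex a.
have [l [_ cY]] := emod_chain_ex b.
have [c [c1 ce ct _]] := chain_top pres cY.
have [xa _ _ _] := cX.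
have : c (f (emod_gen (e a))) != 0.
  apply/negP => /eqP cf0.
  have /mem_limg[z zE] : emod_gen (e b) \in limg f by rewrite ff memvf.
  have /eqP := c1; rewrite zE; suff -> : c (f z) = 0 by rewrite eq_sym oner_eq0.
  apply/eqP; rewrite -comp_lfunE -memv_ker; apply: (chain_mem pres _ cX) => -[|k].
    by rewrite expr0 ract1 memv_ker comp_lfunE cf0.
  by rewrite memv_ker comp_lfunE exprSr ractM hf ct.
by rewrite -{1}xa hf ce; case: (b =P a) => [ba|_ /eqP/(_ erefl)] //; symmetry.
Qed.

Lemma pres_basic : basic_alg B.
Proof.
exists #|V|, (fun i => e (enum_val i)); split.
- by move=> i j; rewrite (cp_orth pres) (inj_eq enum_val_inj).
- rewrite -(cp_one pres) [RHS](reindex (enum_val : 'I_#|V| -> V)) //.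
  by exists enum_rank => i _; [apply: enum_valK | apply: enum_rankK].
- by move=> i; apply: emod_indecomposable.
- by move=> i j ij /emod_iso/enum_val_inj/eqP; rewrite (negPf ij).
Qed.

(** An indecomposable projective [P] is not [P ** t], and so maps onto the
    simple module at some vertex [a]. The lift of this map to the projective
    module at [a] splits off that module, hence is injective. *)
Lemma pres_uniserial P : indecomposable P -> projective P -> uniserial P.
Proof.
move=> [P0 indP] pP.
have Pt : limg (ract_lfun P t) <> fullv.
  move=> Pt; apply: P0; apply: zero_mem => y _.
  have [m tm] := cp_nil pres.
  suff [z ->] : exists z, y = z ** t ^+ m by rewrite tm actr0.
  elim: m {tm} => [|m [z ->]]; first by exists y; rewrite expr0 ract1.
  have /mem_limg[z' ->] : z \in limg (ract_lfun P t) by rewrite Pt memvf.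
  by exists z'; rewrite ract_lfunE -ractM -exprS.
have [z [a [za znt]]] : exists (z : P) a, z ** e a = z /\ z \notin limg (ract_lfun P t).
  have /subvPn[y _ yn] : ~~ (fullv <= limg (ract_lfun P t))%VS.
    by apply/negP => full; apply: Pt; apply/eqP; rewrite eqEsubv subvf.
  have [/existsP[a ya]|/existsPn no] :=
      boolP [exists a, y ** e a \notin limg (ract_lfun P t)].
    by exists (y ** e a), a; rewrite -ractM (cp_orth pres) eqxx.
  case/negP: yn; rewrite (sum_act_e pres y) memv_suml // => a _.
  by have := no a; rewrite negbK.
have [m [ea0 cQ]] := emod_chain_ex a; set Q := emod (e a) in cQ.
have m0 := chain_gt0 cQ.
(* The simple module at [a], and a functional [phi] on [P] that factors through
   [P / P ** t] and separates [z] from [P ** t]. *)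
have [S [x cS]] := @chain_truncate Q a m 1 _ cQ m0.
have [xa xt _ _] := cS; rewrite expr1 in xt.
have [g0 [hg0 g0E]] := chain_univ pres cQ xa (chain_ge cS m0).
have g0full := chain_onto cS hg0 g0E.
pose W := limg (ract_lfun P t).
have [phi [phiW phiz]] : exists phi : 'Hom(P, K^o),
    (forall y, y \in W -> phi y = 0) /\ phi z = 1.
  pose zc := z - projv W z.
  have zc0 : zc != 0.
    by apply: contra znt; rewrite subr_eq0 => /eqP->; apply: memv_proj.
  have fz : free [tuple zc] by rewrite seq1_free.
  have [c cE] : exists c : 'Hom(P, K^o), c =1 coord [tuple zc] 0.
    by apply: linear_hom => k y1 y2; rewrite linearP.
  have [d dE] : exists d : 'Hom(P, P), d =1 fun y => y - projv W y.
    apply: linear_hom => k y1 y2; rewrite linearP scalerBr.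
    by rewrite opprD addrACA.
  exists (c \o d)%VF; split=> [y yW|]; rewrite comp_lfunE dE cE.
    by rewrite projv_id // subrr linear0.
  exact: (coord_free 0 0 fz).
have [f0 f0E] : exists f0 : 'Hom(P, S), f0 =1 fun y => phi (y ** e a) *: x.
  apply: linear_hom => k y1 y2; rewrite actDl actZl linearP scalerDl scalerA.
  by [].
have hf0 : is_hom f0.
  apply: (is_homP pres) => [y v|y]; rewrite !f0E actZl -ractM.
    rewrite (cp_orth pres); have := act_top pres 0 v xa; rewrite expr0 ract1 => ->.
    by rewrite eq_sym; case: eqP => [->//|_]; rewrite actr0 linear0 scale0r scaler0.
  rewrite xt scaler0.
  have -> : t * e a = e (finv s a) * t by rewrite (cp_move pres) f_finv //; apply: cp_inj pres.
  by rewrite ractM phiW ?scale0r //; apply/mem_limg; exists (y ** e (finv s a)); rewrite ract_lfunE.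
have [g [hg gE]] := pP _ _ _ _ hg0 g0full hf0.
have zm : z ** t ^+ m = 0 by rewrite -za -ractM ea0 actr0.
have [f [hf fE]] := chain_univ pres cQ za zm.
have gffull : limg (g \o f)%VF = fullv.
  apply: (chain_lift_gen pres cS cQ hg0 g0E (z := g z)).
  - by rewrite -comp_lfunE gE f0E za phiz scale1r.
  - exact/limg_submodule/is_hom_comp.
  - by rewrite -fE -comp_lfunE memv_img ?memvf.
have kgf := full_ker0 gffull.
have fg0 : (limg f :&: lker g = 0)%VS.
  apply: zero_mem => _ /memv_capP[/mem_limg[q ->]]; rewrite memv_ker => gfq.
  rewrite (_ : q = 0) ?linear0 //; apply: (mem_zero kgf).
  by rewrite memv_ker comp_lfunE.
have fgfull : (limg f + lker g = fullv)%VS.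
  apply: full_mem => y; have /mem_limg[q gq] : g y \in limg (g \o f)%VF.
    by rewrite gffull memvf.
  rewrite -[y](subrKC (f q)) memv_add ?memv_img ?memvf //.
  by rewrite memv_ker linearB /= gq comp_lfunE subrr.
case: (indP _ _ (limg_submodule hf) (lker_submodule hg) fgfull fg0) => [f00|g00].
  case/negP: znt; suff -> : z = 0 by apply: mem0v.
  by apply: (mem_zero f00); rewrite -fE memv_img ?memvf.
move=> U U' sU sU'; have /eqP kg := g00.
have im (U0 : {vspace P}) : submodule U0 -> submodule (g @: U0)%VS.
  by move=> sU0 _ b /memv_imgP[y yU ->]; rewrite -hg memv_img ?sU0.
by have := chain_uniserial pres cQ (im _ sU) (im _ sU'); rewrite !limg_ker0.
Qed.

End ChainConstructions.

Section MoreConstructions.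
Variables (K : fieldType) (B : falgType K) (V : finType).
Variables (s : V -> V) (e : V -> B) (t : B).
Hypothesis pres : cyclic_pres s e t.
Implicit Types (M N P E X Y Z : rmod B) (a b v : V) (I J : finType).
Local Notation chain := (chain e t).

(** A central idempotent acts on each indecomposable [emod (e v)] as 0 or 1,
    and in the same way at both ends of a nonzero arrow. *)
Lemma pres_connected : (forall u v, exists l, iter l s u = v) ->
  (forall v, e v * t != 0) -> connected_alg B.
Proof.
move=> trans et c c2 cC.
have dich v : e v * c = 0 \/ e v * c = e v.
  set X := emod (e v); pose U := lker (ract_lfun X c - \1)%VF.
  pose W := lker (ract_lfun X c).
  have UP (y : X) : reflect (y ** c = y) (y \in U).
    by apply: (iffP eqlfunP); rewrite ract_lfunE id_lfunE.
  have WP (y : X) : reflect (y ** c = 0) (y \in W).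
    by rewrite memv_ker ract_lfunE; apply: eqP.
  have [||||U0|W0] := (emod_indecomposable pres v).2 U W.
  - by move=> y b /UP yc; apply/UP; rewrite -ractM -cC ractM yc.
  - by move=> y b /WP yc; apply/WP; rewrite -ractM -cC ractM yc act0l.
  - apply: full_mem => y; rewrite -[y](subrKC (y ** c)) memv_add //.
      by apply/UP; rewrite -ractM c2.
    by apply/WP; rewrite actBl -ractM c2 subrr.
  - by apply: zero_mem => y /memv_capP[/UP yc /WP]; rewrite yc.
  - left; have : emod_gen (e v) ** c \in U by apply/UP; rewrite -ractM c2.
    by move/(mem_zero U0)/(congr1 val).
  right; have : emod_gen (e v) - emod_gen (e v) ** c \in W.
    by apply/WP; rewrite actBl -ractM c2 subrr.
  by move/(mem_zero W0)/(congr1 val)/eqP; rewrite /= subr_eq0 => /eqP.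
have next v : e v * c = e v -> e (s v) * c = e (s v).
  move=> vc; case: (dich (s v)) => // svc; have := et v.
  by rewrite -vc -mulrA cC mulrA (cp_move pres) -mulrA svc mulr0 eqxx.
have cE : c = \sum_v e v * c by rewrite -mulr_suml (cp_one pres) mul1r.
have [/existsP[u /eqP uc]|/existsPn no] := boolP [exists u, e u * c == e u].
  right; rewrite cE -[RHS](cp_one pres); apply: eq_bigr => v _.
  by have [l <-] := trans u v; elim: l => [|l IHl] //=; apply: next.
left; rewrite cE big1 // => v _; case: (dich v) => // vc.
by have := no v; rewrite vc eqxx.
Qed.

(** ** The opposite algebra *)

Lemma converse_exp (b : B) l : ((b : B^c) ^+ l : B^c) = b ^+ l :> B.
Proof. by elim: l => // l IHl; rewrite exprSr exprS -IHl. Qed.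

Lemma pres_converse : @cyclic_pres K (B^c : falgType K) V (finv s) e t.
Proof.
have s_inj := cp_inj pres; split.
- exact: can_inj (f_finv s_inj).
- move=> u v; rewrite -[LHS]/(e v * e u : B) (cp_orth pres) eq_sym.
  by case: eqP => // ->.
- exact: (cp_one pres).
- move=> v; rewrite -[LHS]/(t * e v : B) -[RHS]/(e (finv s v) * t : B).
  by rewrite (cp_move pres) f_finv.
- by have [m tm] := cp_nil pres; exists m; rewrite converse_exp.
- move=> U Uvl.
  have [f fE] : exists f : 'Hom(B, (B^c : falgType K)), f =1 id by apply: linear_hom.
  apply: full_mem => b; rewrite -[b]fE memv_preim.
  suff -> : (f @^-1: U)%VS = fullv by apply: memvf.
  apply: (cp_gen pres) => v l; rewrite -memv_preim fE (move_exp pres).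
  have := Uvl (iter l s v) l; set y := _ * _; suff <- : y = t ^+ l * e (iter l s v) by [].
  by rewrite /y -converse_exp.
- exact: (cp_nz pres).
Qed.

Lemma pres_nakayama : (forall u v, exists l, iter l s u = v) ->
  (forall v, e v * t != 0) -> nakayama B.
Proof.
move=> trans et; split.
- exact: pres_connected.
- exact: pres_basic pres.
- exact: pres_split pres.
- exact: (pres_uniserial pres).
- exact: (pres_uniserial pres_converse).
Qed.

(** ** Direct sums of chains *)

(** A direct sum of chains, described by its generators and relations. Such a
    module is determined by [top] and [len] up to isomorphism. *)
Record multichain M (I : finType) (G : I -> M) (top : I -> V) (len : I -> nat) : Prop :=
  MultiChain {
    mc_top : forall i, G i ** e (top i) = G i;
    mc_len : forall i, G i ** t ^+ len i = 0;
    mc_nz : forall i, G i ** t ^+ (len i).-1 != 0;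
    mc_gen : forall U : {vspace M}, submodule U -> (forall i, G i \in U) -> U = fullv;
    mc_univ : forall Z (z : I -> Z), (forall i, z i ** e (top i) = z i) ->
      (forall i, z i ** t ^+ len i = 0) ->
      exists f : 'Hom(M, Z), is_hom f /\ forall i, f (G i) = z i }.

Lemma chain_multichain X a m (u : X) :
  chain a m u -> multichain (fun _ : unit => u) (fun=> a) (fun=> m).
Proof.
move=> cX; have [ua um nz ugen] := cX; split=> //.
- by move=> U sU uU; apply: ugen => //; apply: uU tt.
move=> Z z ze zm; have [f [hf fu]] := chain_univ pres cX (ze tt) (zm tt).
by exists f; split=> // -[].
Qed.

Lemma multichain_reindex M I G top len (J : finType) (f : J -> I) g G' top' len' :
  cancel f g -> cancel g f -> @multichain M I G top len ->
  G' =1 G \o f -> top' =1 top \o f -> len' =1 len \o f ->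
  @multichain M J G' top' len'.
Proof.
move=> fK gK [Gt Gl Gnz Ggen Guniv] GE tE lE.
have GE' i : G' (g i) = G i by rewrite GE /= gK.
split=> [j|j|j|U sU GU|Z z zt zl].
- by rewrite GE tE; apply: Gt.
- by rewrite GE lE; apply: Gl.
- by rewrite GE lE; apply: Gnz.
- by apply: Ggen => // i; rewrite -GE'.
have [||h [hh hG]] := Guniv Z (z \o g).
- by move=> i; have := zt (g i); rewrite tE /= gK.
- by move=> i; have := zl (g i); rewrite lE /= gK.
by exists h; split=> // j; rewrite GE hG /= fK.
Qed.

Definition sum_fun (I J T : Type) (f : I -> T) (g : J -> T) (k : I + J) : T :=
  match k with inl i => f i | inr j => g j end.

Lemma multichain_dsum M N I J G top len G' top' len' :
  @multichain M I G top len -> @multichain N J G' top' len' ->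
  @multichain (dsum M N) _ (sum_fun (inl_hom M N \o G) (inr_hom M N \o G'))
    (sum_fun top top') (sum_fun len len').
Proof.
move=> [Gt Gl Gnz Ggen Guniv] [Gt' Gl' Gnz' Ggen' Guniv'].
have hl := @inl_is_hom _ _ M N; have hr := @inr_is_hom _ _ M N.
have El i c : inl_hom M N (G i) ** c = inl_hom M N (G i ** c) by rewrite hl.
have Er j c : inr_hom M N (G' j) ** c = inr_hom M N (G' j ** c) by rewrite hr.
split=> [[i|j]|[i|j]|[i|j]|U sU GU|Z z zt zl].
- by apply: etrans (El _ _) _; rewrite Gt.
- by apply: etrans (Er _ _) _; rewrite Gt'.
- by apply: etrans (El _ _) _; rewrite Gl linear0.
- by apply: etrans (Er _ _) _; rewrite Gl' linear0.
- by apply: contra (Gnz i) => /eqP/(etrans (esym (El _ _))); rewrite inl_homE => -[->].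
- by apply: contra (Gnz' j) => /eqP/(etrans (esym (Er _ _))); rewrite inr_homE => -[->].
- apply: full_mem => v; rewrite (dsum_eta v) memvD // memv_preim.
    rewrite (Ggen (inl_hom M N @^-1: U)%VS) ?memvf // => [w c|i].
      by rewrite -!memv_preim hl; apply: sU.
    by rewrite -memv_preim; apply: (GU (inl i)).
  rewrite (Ggen' (inr_hom M N @^-1: U)%VS) ?memvf // => [w c|i].
    by rewrite -!memv_preim hr; apply: sU.
  by rewrite -memv_preim; apply: (GU (inr i)).
have [||f [hf fG]] := Guniv Z (z \o inl).
- by move=> i; apply: (zt (inl i)).
- by move=> i; apply: (zl (inl i)).
have [||g [hg gG]] := Guniv' Z (z \o inr).
- by move=> i; apply: (zt (inr i)).
- by move=> i; apply: (zl (inr i)).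
have [h [hh hE]] := dsum_homP hf hg; exists h; split=> // -[i|j] /=.
  by rewrite hE inl_homE /= linear0 addr0 fG.
by rewrite hE inr_homE /= linear0 add0r gG.
Qed.

Lemma multichain_bigdsum m (X : 'I_m -> rmod B) (x : forall i, X i) top len :
  (forall i, chain (top i) (len i) (x i)) ->
  exists G, @multichain (\big[@dsum K B/zeromod]_(i < m) X i) 'I_m G top len.
Proof.
elim: m X x top len => [|m IHm] X x top len cX.
  rewrite big_ord0; exists (fun=> 0); split; try by case.
    by move=> U _ _; apply: full_mem => v; rewrite (mem_zero (@zeromod0 K B) (memvf v)) mem0v.
  by move=> Z z _ _; exists 0; split; [apply: is_hom0 | case].
rewrite big_ord_recl.
have [G mG] := IHm _ _ _ _ (fun i => cX (lift ord0 i)).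
pose f (i : 'I_m.+1) : unit + 'I_m := if unlift ord0 i is Some j then inr j else inl tt.
pose g (k : unit + 'I_m) : 'I_m.+1 := if k is inr j then lift ord0 j else ord0.
have fg : cancel f g by move=> i; rewrite /f; case: unliftP => [j|] ->.
have gf : cancel g f.
  by case=> [[]|j]; rewrite /f /g ?liftK // unlift_none.
exists (sum_fun (inl_hom _ _ \o (fun=> x ord0)) (inr_hom _ _ \o G) \o f).
apply: (multichain_reindex fg gf (multichain_dsum (chain_multichain (cX ord0)) mG)) => //.
  by move=> i; rewrite -{1}[i]fg /=; case: (f i).
by move=> i; rewrite -{1}[i]fg /=; case: (f i).
Qed.

Lemma multichain_eq M I G top len Z (f g : 'Hom(M, Z)) :
  @multichain M I G top len -> is_hom f -> is_hom g ->
  (forall i, f (G i) = g (G i)) -> f = g.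
Proof.
move=> mM hf hg fg; apply/lfunP => y; apply/eqlfunP.
suff -> : lker (f - g) = fullv by apply: memvf.
apply: (mc_gen mM) => [z a|i]; last exact/eqlfunP.
by move=> /eqlfunP E; apply/eqlfunP; rewrite hf hg E.
Qed.

Lemma multichain_iso M N I G G' top len :
  @multichain M I G top len -> @multichain N I G' top len -> isomorphic M N.
Proof.
move=> mM mN.
have [f [hf fG]] := mc_univ mM (mc_top mN) (mc_len mN).
have [g [hg gG]] := mc_univ mN (mc_top mM) (mc_len mM).
have gf : (g \o f)%VF = \1%VF.
  apply: (multichain_eq mM); [exact: is_hom_comp | exact: is_hom_id | move=> i].
  by rewrite comp_lfunE fG gG id_lfunE.
have fg : (f \o g)%VF = \1%VF.
  apply: (multichain_eq mN); [exact: is_hom_comp | exact: is_hom_id | move=> i].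
  by rewrite comp_lfunE gG fG id_lfunE.
exists f; split=> //.
  apply: zero_mem => y; rewrite memv_ker => /eqP fy.
  by rewrite -[y]id_lfunE -gf comp_lfunE fy linear0.
by apply: full_mem => y; apply/mem_limg; exists (g y); rewrite -comp_lfunE fg id_lfunE.
Qed.

Lemma regmod_multichain len : (forall v, chain v (len v) (emod_gen (e v))) ->
  @multichain (regmod B) V e id len.
Proof.
move=> cV; have e2 v : e v * e v = e v by rewrite (cp_orth pres) eqxx.
split=> [v|v|v|U sU eU|Z z zt zl].
- exact: e2.
- by have [_ /(congr1 val) + _ _] := cV v.
- by have [_ _ + _] := cV v; apply: contra => /eqP E; apply/eqP/val_inj.
- apply: full_mem => b; rewrite -[b]mul1r -(cp_one pres) mulr_suml memv_suml // => v _.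
  exact: (sU _ b (eU v)).
exists (\sum_v actr (z v)).
have E (b : B) : (\sum_v actr (z v)) b = \sum_v z v ** b.
  by rewrite sum_lfunE; apply: eq_bigr => v _; rewrite actrE.
split=> [b c|u]; first by rewrite !E act_suml; apply: eq_bigr => v _; rewrite ractM.
rewrite E (bigD1 u) //= zt big1 ?addr0 // => v vu.
by rewrite -(zt v) -ractM (cp_orth pres) (negPf vu) actr0.
Qed.

(** The regular module and the direct sum of the [emod (e v)] have the same
    generators and relations. *)
Lemma regmod_profile (P Z : V -> nat -> Prop) : (forall v, has_profile (emod (e v)) (P v) (Z v)) ->
  has_profile (regmod B) (fun k => forall v, P v k) (fun k => forall v, Z v k).
Proof.
move=> pV; have /fin_all_exists[len lenP] v := emod_chain_ex pres v.
have mB := regmod_multichain (fun v => (lenP v).2).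
have [G mG] := multichain_bigdsum (fun i : 'I_#|V| => (lenP (enum_val i)).2).
have mB' : @multichain (regmod B) 'I_#|V| (e \o enum_val) enum_val (len \o enum_val).
  by apply: (multichain_reindex (@enum_valK _) (@enum_rankK _) mB).
apply: (profile_iso (multichain_iso mB' mG)).
apply: profile_ext (profile_bigdsum (fun i : 'I_#|V| => pV (enum_val i))) => // k.
by split=> h v //; rewrite -(enum_rankK v).
Qed.

End MoreConstructions.

(** * Coresolutions of the projective modules *)

Section Profile.
Variables (K : fieldType) (B : falgType K) (V : finType).
Variables (s : V -> V) (e : V -> B) (t : B).
Hypothesis pres : cyclic_pres s e t.
Local Notation chain := (chain e t).

(** The projective module at [v] has length [T.+1] or [T], according to [P]. *)
Variables (T : nat) (P : pred V).
Hypothesis T_gt0 : (0 < T)%N.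
Hypothesis sT : forall v, iter T s v = v.
Hypothesis long0 : forall v, e v * t ^+ T.+1 = 0.
Hypothesis long_nz : forall v, P v -> e v * t ^+ T != 0.
Hypothesis short0 : forall v, ~~ P v -> e v * t ^+ T = 0.
Hypothesis short_nz : forall v, ~~ P v -> e v * t ^+ T.-1 != 0.
Hypothesis sP : forall v, ~~ P v -> P (s v).

Lemma long_chain p : P p -> chain p T.+1 (emod_gen (e p)).
Proof. by move=> Pp; apply: (emod_chain pres) => //; apply: long_nz. Qed.

Lemma short_chain q : ~~ P q -> chain q T (emod_gen (e q)).
Proof. by move=> Pq; apply: (emod_chain pres); [apply: short0 | apply: short_nz]. Qed.

Lemma long_injective (X : rmod B) p (u : X) : chain p T.+1 u -> injective_mod X.
Proof.
move=> cX; apply: (chain_injective pres cX).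
have [v <-] : exists v, iter T.+1 s v = iter T s p.
  exists (invF (iter_inj pres (l := T.+1)) (iter T s p)); exact: f_invF.
by rewrite -(move_exp pres).
Qed.

Lemma long_projective (X : rmod B) p (u : X) : chain p T.+1 u -> projective X.
Proof. by move=> cX; apply: (chain_projective pres cX). Qed.

Lemma profile_long p : P p ->
  has_profile (emod (e p)) (fun=> True) (fun k => (0 < k)%N).
Proof.
move=> Pp; have cX := long_chain Pp.
have pX : projective (emod (e p)) <-> True by split=> // _; apply: long_projective cX.
by apply: profile_ext (profile_injective (long_injective cX) pX); case.
Qed.

(** Walking back from the top [v = iter d.+1 s q] of [X], the first short vertex
    is [q]. The chain at [v] embeds in the projective-injective module at the preceding vertex
    [p], with simple cokernel; the simple module at [p] is the socle of the
    same projective-injective module, with cokernel the chain of length [T] at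
    [p]. Two steps of the coresolution thus move the chain back by one arrow,
    until it stands at [s q] and is injective but not projective. *)
Lemma profile_short q d (X : rmod B) (x : X) : ~~ P q ->
  (forall i, (0 < i <= d)%N -> P (iter i s q)) ->
  chain (iter d.+1 s q) T x ->
  has_profile X (fun k => k <> d.*2) (fun k => (d.*2 < k)%N).
Proof.
move=> Pq; elim: d X x => [|d IHd] X x Pd cX.
  have iX : injective_mod X.
    move: cX; rewrite -(prednK T_gt0) => /(chain_injective pres); apply.
    rewrite prednK // -iterD addn1 prednK // sT.
    by rewrite -{1}(sT q) -(move_exp pres) short0.
  have nX : projective X <-> False.
    split=> // /(chain_not_projective pres cX (long_chain (sP Pq)) (ltnSn T)).
    by [].
  by apply: profile_ext (profile_injective iX nX) => -[|k] //; split.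
pose p := iter d.+1 s q.
have Pp : P p by apply: Pd; rewrite /= leqnn.
have cE := long_chain Pp; have iE := long_injective cE; have pE := long_projective cE.
(* [Y] is the simple module at [p], and [Y'] the cokernel of its embedding. *)
have [Y [y cY]] := chain_truncate pres cE (isT : (0 < 1 <= T.+1)%N).
have [Y' [y' cY']] := chain_truncate pres cE (introT andP (conj T_gt0 (leqnSn T))).
have Pd' i : (0 < i <= d)%N -> P (iter i s q).
  by case/andP=> i0 id; apply: Pd; rewrite i0 leqW.
have pY' := IHd Y' y' Pd' cY'.
have [f [g [[hf hg] kf fg gfull]]] := chain_extension pres (l := 1) (m := T) cE cX cY.
have cY1 : chain (iter T s p) 1 y by rewrite sT.
have cE' : chain p (T + 1) (emod_gen (e p)) by rewrite addn1.
have [f' [g' [[hf' hg'] kf' fg' gfull']]] := chain_extension pres cE' cY1 cY'.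
have ess (Z : rmod B) (h : 'Hom(Z, emod (e p))) : is_hom h -> lker h = 0%VS ->
    {:Z}%VS <> 0%VS -> essential (limg h).
  move=> hh kh Z0; apply: (chain_essential pres cE); first exact: limg_submodule.
  move=> h0; apply: Z0; apply: zero_mem => z _; apply: (mem_zero kh).
  by rewrite memv_ker; apply/eqP/(mem_zero h0)/memv_img/memvf.
have pE1 : projective (emod (e p)) <-> True by [].
have := profile_cons hf' hg' kf' fg' gfull' iE (ess _ _ hf' kf' (chain_full_nz cY)) pE1 pY'.
move/(profile_cons hf hg kf fg gfull iE (ess _ _ hf kf (chain_full_nz cX)) pE1).
apply: profile_ext => -[|[|k]] //=; rewrite ?doubleS //.
by split=> h ?; apply: h; lia.
Qed.

End Profile.

(** * Endomorphism algebras of direct sums of chains *)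

(** The number of arrows of the original algebra that are passed on the [l]
    first steps from [v], when the step out of [v] passes [step v] of them. *)
Fixpoint walk (I : Type) (f : I -> I) (step : I -> nat) (v : I) (l : nat) : nat :=
  if l is l'.+1 then (step v + walk f step (f v) l')%N else 0%N.

Section EndMultichain.
Variables (K : fieldType) (A : falgType K) (V : finType).
Variables (s : V -> V) (e : V -> A) (t : A).
Hypothesis pres : cyclic_pres s e t.
Variables (M : rmod A) (nzM : {:M}%VS <> 0%VS) (I : finType).
Variables (G : I -> M) (top : I -> V) (len : I -> nat).
Hypothesis mM : multichain e t G top len.
Variables (f : I -> I) (step : I -> nat).
Hypothesis f_inj : injective f.
Hypothesis top_f : forall v, top (f v) = iter (step v) s (top v).
Hypothesis len_f : forall v, (len v <= len (f v) + step v)%N.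
Hypothesis walk_nil : exists m, forall v, (len v <= walk f step v m)%N.
Hypothesis walk_onto : forall u v k, (k < len u)%N -> iter k s (top u) = top v ->
  (len u <= k + len v)%N -> exists l, iter l f u = v /\ walk f step u l = k.
Local Notation B := (endalg nzM).
Local Notation walk := (walk f step).

Lemma iter_f_inj l : injective (iter l f).
Proof. by elim: l => //= l IHl x y /f_inj/IHl. Qed.

Lemma iter_f_onto l i : exists u, iter l f u = i.
Proof. by exists (invF (@iter_f_inj l) i); apply: f_invF. Qed.

Lemma gen_exp0 v k : (G v ** t ^+ k == 0) = (len v <= k)%N.
Proof.
apply/eqP/idP => [Gk|lk]; last first.
  by rewrite -(subnKC lk) exprD ractM (mc_len mM) act0l.
rewrite leqNgt; apply/negP => kl; have /eqP := mc_nz mM v; apply.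
have -> : ((len v).-1 = k + ((len v).-1 - k))%N by lia.
by rewrite exprD ractM Gk act0l.
Qed.

Lemma proj_exists v : exists p : B,
  forall i, vsval p (G i) = if i == v then G i else 0.
Proof.
have [||p [hp pE]] := mc_univ mM (z := fun i => if i == v then G i else 0).
- by move=> i; case: ifP => _; rewrite ?act0l ?(mc_top mM).
- by move=> i; case: ifP => _; rewrite ?act0l ?(mc_len mM).
by exists (Subvs (introT (endspaceP _) hp)).
Qed.

Lemma arrow_exists : exists a : B, forall v, vsval a (G (f v)) = G v ** t ^+ step v.
Proof.
have finvK v : f (finv f v) = v by apply: f_finv.
have [||p [hp pE]] := mc_univ mM (z := fun i => G (finv f i) ** t ^+ step (finv f i)).
- move=> i; rewrite (act_top pres _ _ (mc_top mM _)).
  by rewrite -top_f finvK eqxx.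
- move=> i; rewrite -ractM -exprD; apply/eqP; rewrite gen_exp0 addnC.
  by have := len_f (finv f i); rewrite finvK.
exists (Subvs (introT (endspaceP _) hp)) => v.
by rewrite /= pE finv_f.
Qed.

Lemma end_hom (b : B) : is_hom (vsval b).
Proof. exact/endspaceP/subvsP. Qed.

Lemma end_ext (b b' : B) : (forall i, vsval b (G i) = vsval b' (G i)) -> b = b'.
Proof.
by move=> bb'; apply/val_inj/(multichain_eq mM) => //; apply: end_hom.
Qed.

Lemma end_mulE (b b' : B) y : vsval (b * b') y = vsval b (vsval b' y).
Proof. by rewrite -comp_lfunE. Qed.

Lemma gen_chain u : exists (sX : submodule (limg (actr (G u)))) (x : submod sX),
  val x = G u /\ chain e t (top u) (len u) x.
Proof.
have sX := @cyclic_submodule _ _ _ (G u); exists sX.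
have Gu : G u \in limg (actr (G u)) by apply/mem_limg; exists 1; rewrite actrE ract1.
exists (Subvs Gu); split=> //; split.
- by apply: val_inj; rewrite /= (mc_top mM).
- by apply: val_inj; rewrite /= (mc_len mM).
- by apply/negP => /eqP/(congr1 val)/= /eqP; rewrite (negPf (mc_nz mM u)).
move=> U sU uU; apply: full_mem => z; have /mem_limg[a za] := subvsP z.
suff -> : z = (Subvs Gu : submod sX) ** a by apply: sU.
by apply: val_inj; rewrite /= za actrE.
Qed.

Lemma ann_submodule (X : rmod A) l : submodule (lker (ract_lfun X (t ^+ l))).
Proof.
apply: (submoduleP pres) => [y v|y]; rewrite !memv_ker !ract_lfunE => /eqP y0.
  by rewrite -ractM (move_exp pres) ractM y0 act0l.
by rewrite -ractM -exprS exprSr ractM y0 act0l.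
Qed.

(** Paths starting at [v] in the endomorphism algebra are walks along [f]; such
    a path is the map that sends the generator at its end to
    [G v ** t ^+ walk v l]. By [walk_onto] these are all the maps between
    generators that the relations allow. *)
Lemma endalg_pres : exists (e' : I -> B) (t' : B),
  cyclic_pres f e' t' /\
  forall v l, (e' v * t' ^+ l == 0) = (len v <= walk v l)%N.
Proof.
have /fin_all_exists[p pE] := proj_exists; have [a aE] := arrow_exists.
have aexp l v : vsval (a ^+ l) (G (iter l f v)) = G v ** t ^+ walk v l.
  elim: l v => [|l IHl] v; first by rewrite !expr0 ract1 /= id_lfunE.
  rewrite exprS end_mulE iterSr IHl end_hom aE /= -ractM -exprD.
  by [].
have paE l u v : vsval (p v * a ^+ l) (G (iter l f u)) =
    if u == v then G v ** t ^+ walk v l else 0.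
  rewrite end_mulE aexp end_hom pE; case: eqP => [->//|_]; exact: act0l.
have pa0 v l : (p v * a ^+ l == 0) = (len v <= walk v l)%N.
  rewrite -gen_exp0; apply/eqP/eqP => [pal|Gv].
    by have := paE l v v; rewrite pal eqxx zero_lfunE.
  apply: end_ext => i; have [u <-] := iter_f_onto l i.
  by rewrite paE Gv zero_lfunE; case: ifP.
exists p, a; split=> //; split=> //.
- move=> u v; apply: end_ext => i; rewrite end_mulE pE.
  have [->|uv] := eqVneq u v.
    by rewrite [RHS]pE; case: eqP => [->|_]; rewrite ?pE ?eqxx ?linear0.
  rewrite zero_lfunE; case: eqP => [->|_]; last by rewrite linear0.
  by rewrite pE eq_sym (negPf uv).
- apply: end_ext => i; rewrite raddf_sum sum_lfunE (bigD1 i) //= pE eqxx.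
  rewrite id_lfunE big1 ?addr0 // => v vi; rewrite pE eq_sym (negPf vi).
  by [].
- move=> v; apply: end_ext => i; have [u <-] := iter_f_onto 1 i.
  rewrite -[X in p v * X]expr1 paE end_mulE pE (inj_eq f_inj) /= addn0.
  by case: eqP => [->|_]; rewrite ?aE ?linear0.
- have [m lenm] := walk_nil; exists m; apply: end_ext => i.
  have [u <-] := iter_f_onto m i; rewrite aexp zero_lfunE.
  by apply/eqP; rewrite gen_exp0.
- move=> U paU; apply: full_mem => b.
  have p1 : \sum_v p v = 1.
    apply: end_ext => i; rewrite raddf_sum sum_lfunE (bigD1 i) //= pE eqxx.
    by rewrite id_lfunE big1 ?addr0 // => v vi; rewrite pE eq_sym (negPf vi).
  rewrite -[b]mul1r -[X in X * b]p1 mulr_suml memv_suml // => u _.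
  rewrite -[_ * _]mulr1 -p1 mulr_sumr memv_suml // => v _.
  (* The map [p u * b * p v] is determined by the image of [G v], a combination
     [y] of the [G u ** t ^+ k]; the relations at [v] leave only those [k] to
     which [walk_onto] applies. *)
  have [sX [x [xE cX]]] := gen_chain u.
  have yX : vsval (p u) (vsval b (G v)) \in limg (actr (G u)).
    rewrite memv_preim; set W := (_ @^-1: _)%VS.
    suff -> : W = fullv by apply: memvf.
    apply: (mc_gen mM) => [z c|i]; rewrite -!memv_preim.
      by rewrite end_hom; apply: sX.
    rewrite pE; case: eqP => [->|_]; last exact: mem0v.
    by apply/mem_limg; exists 1; rewrite actrE ract1.
  pose y : submod sX := Subvs yX.
  have [c [cE _]] := chain_coords pres cX.
  have ytop : val y ** e (top v) = val y by rewrite /= -!end_hom (mc_top mM).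
  have ylen : y \in lker (ract_lfun (submod sX) (t ^+ len v)).
    rewrite memv_ker ract_lfunE; apply/eqP/val_inj.
    by rewrite /= -!end_hom (mc_len mM) !linear0.
  have /fin_all_exists[F FE] : forall k : 'I_(len u), exists F : B, F \in U /\
      forall i, vsval F (G i) =
        if i == v then c k y *: (G u ** t ^+ k ** e (top v)) else 0.
    move=> k; have [ck0|ck] := eqVneq (c k y) 0.
      exists 0; split=> [|i]; first exact: mem0v.
      by rewrite zero_lfunE ck0 scale0r; case: ifP.
    have := chain_mono cX cE (@ann_submodule _ _) ylen (ltn_ord k) ck.
    rewrite memv_ker ract_lfunE -ractM -exprD => /eqP/(congr1 val)/= /eqP.
    rewrite xE gen_exp0 => lenk; rewrite (act_top pres _ _ (mc_top mM u)).
    have [ktop|ktop] := eqVneq (iter k s (top u)) (top v); last first.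
      exists 0; split=> [|i]; first exact: mem0v.
      by rewrite zero_lfunE scaler0; case: ifP.
    have [l [lv lk]] := walk_onto (ltn_ord k) ktop lenk.
    exists ((c k y : K) *: (p u * a ^+ l : B)); split=> [|i]; first exact: memvZ.
    rewrite scale_lfunE; have [w <-] := iter_f_onto l i.
    rewrite paE -lv (inj_eq (@iter_f_inj l)) lk.
    by case: eqP; rewrite ?scaler0.
  suff -> : p u * b * p v = \sum_k F k by apply: memv_suml => k _; case: (FE k).
  apply: end_ext => i; rewrite !end_mulE pE raddf_sum sum_lfunE.
  under eq_bigr => k _ do rewrite (FE k).2.
  case: eqP => [->|_]; last by rewrite !linear0 big1.
  rewrite -[LHS]ytop [in LHS](cE y) raddf_sum act_suml; apply: eq_bigr => k _.
  by rewrite /= actZl xE.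
- move=> v; rewrite -[p v]mulr1 -(expr0 a) pa0 /= -ltnNge.
  by have := gen_exp0 v 0; rewrite expr0 ract1; have := mc_nz mM v; case: (len v) => //=; rewrite expr0 ract1 => /negPf->.
Qed.

End EndMultichain.

(** * The summands of the special module *)

Section CycPresentation.
Variables (K : fieldType) (n w : nat).
Local Notation A := (cycalg K n w).
Local Notation path := (cyc_path K w).
Implicit Types (i j : 'I_n.+1) (f g : A).

Definition rot1 i : 'I_n.+1 := inZp (i + 1).
Definition cyc_arrow : A := \sum_i path i 1.

Lemma iter_rot1 k i : iter k rot1 i = inZp (i + k).
Proof.
elim: k => [|k IHk]; first by rewrite addn0 inZp_ord.
by rewrite iterS IHk /rot1; apply: val_inj; rewrite /= modnDml -addnA addn1.
Qed.

Lemma rot1_inj : injective rot1.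
Proof.
move=> i j /(congr1 val)/= /eqP; rewrite eqn_modDr !modn_small // => /eqP.
exact: val_inj.
Qed.

Lemma path_arrow i k : path i k * cyc_arrow = path i k.+1.
Proof.
rewrite mulr_sumr (bigD1 (inZp (i + k))) //= cyc_pathM eqxx addn1 big1 ?addr0 // => j ji.
by rewrite cyc_pathM eq_sym (negPf ji).
Qed.

Lemma idem_exp i k : cyc_idem K w i * cyc_arrow ^+ k = path i k.
Proof.
elim: k => [|k IHk]; first by rewrite expr0 mulr1.
by rewrite exprSr mulrA IHk path_arrow.
Qed.

Lemma path_nz i k : (k <= w)%N -> path i k != 0.
Proof.
move=> kw; apply/eqP => /ffunP/(_ (i, inord k)); rewrite !ffunE /= inordK // !eqxx.
by move/eqP; rewrite oner_eq0.
Qed.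

Lemma sum_idem : \sum_(i < n.+1) cyc_idem K w i = 1 :> A.
Proof.
apply/ffunP => -[i l]; rewrite sum_ffunE (bigD1 i) //= !ffunE eqxx /= big1 ?addr0 //.
by move=> j ji; rewrite ffunE /= eq_sym (negPf ji).
Qed.

Lemma cyc_pres : cyclic_pres rot1 (cyc_idem K w) cyc_arrow.
Proof.
split.
- exact: rot1_inj.
- by move=> i j; rewrite cyc_pathM !addn0 inZp_ord.
- exact: sum_idem.
- move=> i; rewrite path_arrow mulr_suml (bigD1 i) //= cyc_pathM eqxx addn0.
  rewrite big1 ?addr0 // => j ji; rewrite cyc_pathM.
  by case: eqP => // /rot1_inj ij; rewrite ij eqxx in ji.
- exists w.+1; rewrite -[LHS]mul1r -sum_idem mulr_suml big1 // => i _.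
  by rewrite idem_exp cyc_path0.
- move=> U Ut; apply: full_mem => f; rewrite [f]cyc_expand memv_suml // => u _.
  by rewrite memvZ // -idem_exp.
- by move=> i; exact: (path_nz i (leq0n w)).
Qed.

Lemma idem_chain i :
  chain (cyc_idem K w) cyc_arrow i w.+1 (emod_gen (cyc_idem K w i)).
Proof.
apply: (emod_chain cyc_pres); rewrite idem_exp; first by rewrite cyc_path0.
exact: (path_nz i (leqnn w)).
Qed.

(** This holds on the [m]-th power of the radical ([no_short_rad]). *)
Definition no_short m f := forall i (l : 'I_w.+1), (l < m)%N -> f (i, l) = 0.

Lemma no_shortM m p f g : no_short m f -> no_short p g -> no_short (m + p) (f * g).
Proof.
move=> fm gp i l lmp; rewrite cyc_mulE big1 // => k _.
have kl : (k <= l)%N by rewrite -ltnS.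
have lw := ltn_ord l.
have [km|mk] := ltnP k m; first by rewrite fm ?mul0r // inordK // (leq_trans _ lw).
by rewrite gp ?mulr0 // inordK; lia.
Qed.

Lemma no_short_prod m p (U W : {vspace A}) :
  (forall f, f \in U -> no_short m f) -> (forall f, f \in W -> no_short p f) ->
  forall f, f \in (U * W)%VS -> no_short (m + p) f.
Proof.
move=> Um Wp f fUW i l lmp.
have [F FE] : exists F : 'Hom(A, K^o), F =1 fun g => g (i, l).
  by apply: linear_hom => k g h; rewrite !ffunE.
have : (U * W <= lker F)%VS.
  apply/prodvP => g h gU hW; rewrite memv_ker FE; apply/eqP.
  by apply: (no_shortM (Um _ gU) (Wp _ hW)).
by move/subvP/(_ f fUW); rewrite memv_ker FE => /eqP.
Qed.

Lemma no_short_rad m f : f \in (cyc_rad K n w ^+ m)%VS -> no_short m f.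
Proof.
elim: m f => [|m IHm] f; first by move=> _ i l; rewrite ltn0.
rewrite expvSl -add1n; apply: no_short_prod => // g /cyc_radP g0 i l.
by rewrite ltnS leqn0 => /eqP l0; rewrite -(g0 i); congr (g (_, _)); apply: val_inj.
Qed.

Lemma memv_exp f (U : {vspace A}) m : f \in U -> f ^+ m \in (U ^+ m)%VS.
Proof.
by move=> fU; elim: m => [|m IHm]; [apply: memv_line | rewrite exprS expvSl memv_mul].
Qed.

Lemma equot_chain i : (0 < w)%N -> exists x : equot (cyc_idem K w i) (cyc_rad K n w ^+ w)%VS,
  chain (cyc_idem K w) cyc_arrow i w x.
Proof.
move=> w0; set U := (cyc_rad K n w ^+ w)%VS.
exists (quot_proj (@esub_submodule _ _ (cyc_idem K w i) U) (emod_gen (cyc_idem K w i))).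
apply: (chain_quot _ (idem_chain i)); rewrite /esub -memv_preim lfunE /=.
  rewrite -[_ * _]mulr1; apply: memv_mul (memvf _); apply: memv_mul (memv_line _) _.
  have tJ : cyc_arrow \in cyc_rad K n w.
    apply/cyc_radP => j; rewrite sum_ffunE big1 // => k _.
    by rewrite ffunE /= andbF.
  exact: memv_exp.
apply/negP => pU; have : no_short (0 + w + 0) (cyc_idem K w i * cyc_arrow ^+ w.-1).
  apply: no_short_prod pU => [f|f _ j l]; last by rewrite ltn0.
  by apply: no_short_prod => [g _ j l|g /no_short_rad//]; rewrite ltn0.
move/(_ i (inord w.-1)); rewrite inordK; last by lia.
rewrite idem_exp ffunE /= eqxx inordK ?eqxx; last by lia.
by rewrite addn0 add0n prednK // leqnn => /(_ isT)/eqP; rewrite oner_eq0.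
Qed.

End CycPresentation.

(** * The quiver of the endomorphism algebra *)

Section Quiver.
Variables (n r : nat) (x : 'I_r -> 'I_n.+1).
Hypothesis x_inj : injective x.
Local Notation vertex := ('I_n.+1 + 'I_r)%type.
Implicit Types (u v : vertex) (i : 'I_n.+1) (j : 'I_r).

(** The vertex [inl i] stands for the projective summand at [i] of the special
    module, and [inr j] for the nonprojective summand at [x j]. The irreducible
    maps between summands insert [inr j] just before [inl (x j)] in the cycle. *)
Definition place i : vertex := if [pick j | x j == i] is Some j then inr j else inl i.

Definition succ v : vertex :=
  match v with inl i => place (rot1 i) | inr j => inl (x j) end.

Definition vtop : vertex -> 'I_n.+1 := sum_fun id x.
Definition is_long v : bool := if v is inl _ then true else false.

Lemma place_special j : place (x j) = inr j.
Proof.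
rewrite /place; case: pickP => [j' /eqP/x_inj -> //|/(_ j)].
by rewrite eqxx.
Qed.

Lemma place_ordinary i : (forall j, x j <> i) -> place i = inl i.
Proof. by move=> xi; rewrite /place; case: pickP => // j /eqP/xi. Qed.

Lemma vtop_place i : vtop (place i) = i.
Proof. by rewrite /place; case: pickP => [j /eqP|]. Qed.

Lemma succ_inj : injective succ.
Proof.
move=> [i|j] [i'|j'] /=.
- by move/(congr1 vtop); rewrite !vtop_place => /rot1_inj->.
- move=> E; have := congr1 vtop E; rewrite vtop_place /= => iE.
  by move: E; rewrite iE place_special.
- move=> E; have := congr1 vtop E; rewrite vtop_place /= => iE.
  by move: E; rewrite -iE place_special.
- by case=> /x_inj->.
Qed.

Lemma is_long_succ v : ~~ is_long v -> is_long (succ v).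
Proof. by case: v. Qed.

Lemma vtop_succ v : vtop (succ v) = iter (is_long v) (@rot1 n) (vtop v).
Proof. by case: v => [i|j] //=; rewrite vtop_place. Qed.

Local Notation walk := (walk succ is_long).

Lemma walkD v k l : walk v (k + l) = (walk v k + walk (iter k succ v) l)%N.
Proof.
by elim: k v => [|k IHk] v //; rewrite addSn /= IHk addnA -iterS iterSr.
Qed.

Lemma walk_double v k : (k <= walk v k.*2)%N.
Proof.
elim: k v => // k IHk v; rewrite doubleS /=.
have := IHk (succ (succ v)); have := @is_long_succ v.
by case: (is_long v) => [|/(_ isT) ->]; lia.
Qed.

(** Along [k] arrows of the original algebra one comes to any summand with the
    right top. For [k = 0] the only exception is the way from a projective
    summand to a special one with the same top, which would have to run
    backwards. *)
Lemma walk_reach u v k : iter k (@rot1 n) (vtop u) = vtop v ->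
  (0 < k)%N || ~~ is_long u || is_long v ->
  exists l, iter l succ u = v /\ walk u l = k.
Proof.
elim: k v => [|k IHk] v.
  case: u v => [i|j] [i'|j'] //= ij _.
  - by exists 0%N; rewrite /= ij.
  - by exists 1%N; rewrite /= ij.
  - by exists 0%N; rewrite (x_inj ij).
move=> kv _; set i := iter k (@rot1 n) (vtop u).
have [] := IHk (inl i) erefl (orbT _) => l [lu lk].
have step1 : iter l.+1 succ u = place (vtop v) by rewrite iterS lu /= -kv.
have walk1 : walk u l.+1 = k.+1 by rewrite -[l.+1]addn1 walkD lk lu /= addn0 addn1.
case: v kv step1 => [i'|j] kv step1; last first.
  by exists l.+1; rewrite step1 place_special.
case: (pickP (fun j => x j == i')) => [j /eqP ji|no].
  exists l.+2; rewrite iterS step1 -[l.+2]addn1 walkD walk1 step1 /= -ji place_special /=.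
  by rewrite !addn0.
by exists l.+1; rewrite step1 place_ordinary // => j; apply/eqP; rewrite no.
Qed.

Lemma succ_transitive u v : exists l, iter l succ u = v.
Proof.
have [||l [lv _]] := @walk_reach u v (vtop v + n.+1 - vtop u)%N; last by exists l.
  rewrite iter_rot1; apply: val_inj; rewrite /= subnKC; last first.
    by rewrite (leq_trans (ltnW (ltn_ord _))) // leq_addl.
  by rewrite modnDr modn_small.
by rewrite subn_gt0 (leq_trans (ltn_ord _)) ?leq_addl.
Qed.

Lemma order_succ v : order succ v = #|{: vertex}|.
Proof.
apply: eq_card => u; rewrite !inE; have [l <-] := succ_transitive v u.
exact: fconnect_iter.
Qed.

(** One turn visits each vertex once, and an arrow of the original algebra is
    passed on leaving each of the [n.+1] ordinary vertices. *)
Lemma walk_period v : walk v #|{: vertex}| = n.+1.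
Proof.
have walkE l u : walk u l = (\sum_(v <- traject succ u l) is_long v)%N.
  by elim: l u => [|l IHl] u; rewrite ?big_nil // trajectS big_cons -IHl.
rewrite walkE -(order_succ v) -/(orbit succ v) big_uniq ?orbit_uniq //=.
rewrite (eq_bigl xpredT) => [|u]; last first.
  by rewrite -fconnect_orbit; have [l <-] := succ_transitive v u; apply: fconnect_iter.
by rewrite big_sumType /= sum1_card card_ord big1 ?addn0.
Qed.

Lemma iter_period v k : iter (k * #|{: vertex}|) succ v = v.
Proof.
elim: k => // k IHk; rewrite mulSn addnC iterD -(order_succ v).
by rewrite (iter_order succ_inj) order_succ.
Qed.

Lemma walk_periods v k : walk v (k * #|{: vertex}|) = (k * n.+1)%N.
Proof.
elim: k => // k IHk; rewrite !mulSn addnC walkD IHk iter_period walk_period.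
exact: addnC.
Qed.

(** ** Distances between special points *)

Lemma gap_ordinary j k : (k < next_dist x j)%N ->
  iter k.+1 succ (inr j) = inl (iter k (@rot1 n) (x j)).
Proof.
rewrite /next_dist; case: ex_minnP => b _ bmin.
elim: k => // k IHk kb; rewrite iterS IHk /=; last exact: ltnW.
rewrite place_ordinary // => j' xj'.
suff : reaches x j k.+1 by move/bmin; rewrite leqNgt kb.
apply/existsP; exists j'; rewrite xj' -iterS iter_rot1.
by rewrite /= modn_mod.
Qed.

Lemma next_dist_gt0 j : (0 < next_dist x j)%N.
Proof. by rewrite /next_dist; case: ex_minnP => b /andP[]. Qed.

Lemma gap_special j : exists j', iter (next_dist x j).+1 succ (inr j) = inr j'.
Proof.
have d0 := next_dist_gt0 j.
have := @gap_ordinary j (next_dist x j).-1; rewrite prednK // => /(_ (leqnn _)).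
rewrite iterS => ->; have : reaches x j (next_dist x j).
  by rewrite /next_dist; case: ex_minnP.
case/andP=> _ /existsP[j' /eqP xj]; exists j'; rewrite /= -iterS prednK //.
rewrite iter_rot1 (_ : inZp _ = x j') ?place_special //; apply: val_inj.
by rewrite /= xj modn_small.
Qed.

(** The map to the next special point is injective: walking back from a common
    next point, the first special vertex that is met is unique. *)
Lemma gap_exists : exists2 prev : 'I_r -> 'I_r, bijective prev &
  forall j, iter (next_dist x (prev j)).+1 succ (inr (prev j)) = inr j.
Proof.
have /fin_all_exists[next nextE] := gap_special.
have next_inj : injective next.
  suff wlog_le j k : (next_dist x j <= next_dist x k)%N -> next j = next k -> j = k.
    move=> j k jk; have [le|/ltnW le] := leqP (next_dist x j) (next_dist x k).
      exact: wlog_le.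
    exact/esym/wlog_le.
  move=> le jk; have := nextE k; rewrite -jk -nextE -(subnKC le) -addSn iterD.
  move/(iter_f_inj succ_inj); case: (next_dist x k - _)%N (subnKC le) => [|d] E; first by case.
  by rewrite gap_ordinary // -E; lia.
exists (invF next_inj); last by move=> j; rewrite nextE f_invF.
by exists next => j; [apply: f_invF | apply: invF_f].
Qed.

Lemma min_distP (r_gt0 : (0 < r)%N) :
  (exists j, next_dist x j = min_dist x r_gt0) /\
  (forall j, (min_dist x r_gt0 <= next_dist x j)%N).
Proof.
rewrite /min_dist; case: ex_minnP => m /existsP[j jm] mmin.
have mj k : (m <= next_dist x k)%N.
  by apply: mmin; apply/existsP; exists k; rewrite /next_dist; case: ex_minnP.
split=> //; exists j; apply/eqP; rewrite eqn_leq mj andbT.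
by rewrite /next_dist; case: ex_minnP => b _; apply.
Qed.

End Quiver.

Section Main.
Variables (K : fieldType) (n w r : nat) (x : 'I_r -> 'I_n.+1).
Hypothesis w_gt0 : (0 < w)%N.
Hypothesis x_inj : injective x.

Definition vlen : 'I_n.+1 + 'I_r -> nat := sum_fun (fun=> w.+1) (fun=> w).

Lemma special_multichain : exists G : 'I_n.+1 + 'I_r -> special_mod K w x,
  multichain (cyc_idem K w) (cyc_arrow K n w) G (vtop x) vlen.
Proof.
have pres := cyc_pres K n w.
have [G mG] := multichain_bigdsum pres (fun i => idem_chain K w i).
have /fin_all_exists[y yE] := fun j => equot_chain K (x j) w_gt0.
have [G' mG'] := multichain_bigdsum pres yE.
by exists (sum_fun (inl_hom _ _ \o G) (inr_hom _ _ \o G')); apply: multichain_dsum.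
Qed.

Lemma special_pres : exists (e : 'I_n.+1 + 'I_r -> endalg (special_mod_nz K w x)) t,
  cyclic_pres (succ x) e t /\
  forall v l, (e v * t ^+ l == 0) = (vlen v <= walk (succ x) (@is_long _ _) v l)%N.
Proof.
have [G mG] := special_multichain.
apply: (endalg_pres (cyc_pres K n w) _ mG (succ_inj x_inj)).
- by move=> v; rewrite vtop_succ.
- move=> [i|j]; last by rewrite addn0 /= leqnSn.
  have lp : (w <= vlen (place x (rot1 i)))%N by rewrite /place; case: pickP.
  by rewrite addnC; apply: (leq_add (leqnn 1) lp).
- exists w.+1.*2 => v; apply: leq_trans (walk_double x v w.+1).
  by case: v.
move=> u v k ku kv uv; apply: walk_reach => //.
by case: u v uv {kv ku} => [i|j] [i'|j'] //= kw; rewrite ?orbT // !orbF; lia.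
Qed.

Lemma special_endalg_dims (r_gt0 : (0 < r)%N) : (n.+1 %| w)%N ->
  let B : falgType K := endalg (special_mod_nz K w x) in
  [/\ nakayama B, is_domdim B (2 * min_dist x r_gt0)%N &
      is_gorenstein_dim B (2 * max_next_dist x)%N].
Proof.
move=> dvd_w B; have [e [t [pres etE]]] := special_pres.
have et0 v l : (vlen v <= walk (succ x) (@is_long _ _) v l)%N -> e v * t ^+ l = 0.
  by move=> h; apply/eqP; rewrite etE.
(* The length of the path that passes [w] arrows of the original algebra. *)
pose T := (w %/ n.+1 * #|{: 'I_n.+1 + 'I_r}|)%N.
have sT v : iter T (succ x) v = v by apply: iter_period.
have wT v : walk (succ x) (@is_long _ _) v T = w by rewrite walk_periods // divnK.
have T_gt0 : (0 < T)%N.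
  rewrite muln_gt0 divn_gt0 // dvdn_leq //=.
  by apply/card_gt0P; exists (inl ord0).
have long0 v : e v * t ^+ T.+1 = 0.
  apply: et0; rewrite -[T.+1]addn1 walkD wT sT /= addn0.
  by case: v => [i|j] /=; rewrite ?addn1 ?addn0.
have long_nz v : is_long v -> e v * t ^+ T != 0.
  by case: v => // i _; rewrite etE wT ltnn.
have short0 v : ~~ is_long v -> e v * t ^+ T = 0.
  by case: v => // j _; apply: et0; rewrite wT.
have short_nz v : ~~ is_long v -> e v * t ^+ T.-1 != 0.
  case: v => // j _; rewrite etE -ltnNge /=.
  have : is_long (iter T.-1 (succ x) (inr j)).
    have := sT (inr j); rewrite -{1}(prednK T_gt0) iterS.
    by case: (iter _ _ _).
  move: (wT (inr j)); rewrite -{1}(prednK T_gt0) -[T.-1.+1]addn1 walkD /= addn0.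
  by case: (is_long _) => //= <- _; rewrite addn1.
have /gap_exists[prev prev_bij prevE] := x_inj.
pose d j := next_dist x (prev j).
pose P (v : 'I_n.+1 + 'I_r) k := if v is inr j then k <> (d j).*2 else True.
pose Z (v : 'I_n.+1 + 'I_r) k := if v is inr j then ((d j).*2 < k)%N else (0 < k)%N.
have prof : has_profile (regmod B) (fun k => forall v, P v k) (fun k => forall v, Z v k).
  apply: (regmod_profile pres) => -[i|j].
    exact: (profile_long pres long0 long_nz).
  have cj := short_chain pres short0 short_nz (isT : ~~ is_long (inr j)).
  have cj' : chain e t (iter (d j).+1 (succ x) (inr (prev j))) T (emod_gen (e (inr j))).
    by rewrite /d prevE.
  apply: (profile_short pres T_gt0 sT long0 long_nz short0 (@is_long_succ _ _ x) _ _ cj') => //.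
  by case=> // k /= kd; rewrite -iterS gap_ordinary.
split.
- apply: (pres_nakayama pres); first exact: succ_transitive.
  move=> v; rewrite -[t]expr1 etE -ltnNge /= addn0.
  by case: v => [i|j] //=; rewrite ltnS.
- have [[j jm] mmin] := min_distP x r_gt0; have [next pK nK] := prev_bij.
  have m0 : (0 < min_dist x r_gt0)%N by rewrite -jm next_dist_gt0.
  rewrite -[(2 * _)%N]prednK ?muln_gt0 //; apply: (profile_domdim prof).
    move=> k km [i|j'] //=; have := mmin (prev j'); rewrite -/(d j') => md kd.
    by move: km; rewrite kd; lia.
  move=> /(_ (inr (next j))) /=; apply; rewrite /d nK jm prednK ?muln_gt0 //.
  by rewrite mul2n.
have max_le j : (next_dist x j <= max_next_dist x)%N by apply: leq_bigmax.
apply: (profile_injdim prof) => [k mk [i|j] /=|].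
- exact: leq_ltn_trans mk.
- by apply: leq_ltn_trans mk; rewrite -mul2n leq_mul2l max_le.
have [next pK nK] := prev_bij.
have card_r : (0 < #|'I_r|)%N by rewrite card_ord.
have [j jE] := eq_bigmax (next_dist x) card_r.
by move=> /(_ (inr (next j))) /=; apply; rewrite /d nK -jE mul2n.
Qed.

End Main.

Theorem mainTheorem4 (K : fieldType) (n w r : nat)
    (nonsemisimple : (0 < w)%N)
    (symA : symmetric_algebra (cycalg K n w))
    (r_gt0 : (0 < r)%N) (x : 'I_r -> 'I_n.+1) (x_inj : injective x) :
  let B : falgType K := endalg (special_mod_nz K w x) in
  [/\ nakayama B,
      is_domdim B (2 * min_dist x r_gt0)%N &
      is_gorenstein_dim B (2 * max_next_dist x)%N].
Proof.
apply: special_endalg_dims => //; move/cyc_symmetricP: symA => /eqP.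
by rewrite -addn1 -{2}[1%N]add0n eqn_modDr mod0n.
Qed.
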